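(* (i) An $m\times m$-valued rational function $F(s)$ is a canonical $\mathcal{HP}_T$ function, for some $I_m\succ T\succ 0$, if and only if it admits an $(n+m)\times(n+m)$ minimal realization $R_F$ of the form $$R_F=\begin{pmatrix}A&B\\C&D\end{pmatrix}=\begin{pmatrix}-\frac12C^*TC+Y & C^*T^{\frac12}U(T^{-1}-T)^{\frac12}\\ C& T^{-1}-T^{-\frac12}U(T^{-1}-T)^{\frac12}\end{pmatrix},$$ where the parameters are: $U\in\mathbb{C}^{m\times m}$ with $U^*U=I_m$; $Y\in\mathbb{C}^{n\times n}$ with $Y+Y^*=0$; $C\in\mathbb{C}^{m\times n}$ of full rank; and the pair $(Y,C)$ is observable. (ii) $F(s)$ is a canonical $\mathcal{HP}_\beta$ function, for some $\beta\in(0,1)$, if and only if a corresponding $(n+m)\times(n+m)$ balanced realization $\hat R_F$ takes the form $$\hat R_F=\begin{pmatrix}-\frac{\beta}{2}C^*C+Y&(1-\beta^2)^{\frac14}C^*U\\ (1-\beta^2)^{\frac14}C&\frac1\beta\left(I_m-\sqrt{1-\beta^2}\,U\right)\end{pmatrix},$$ where the parameters are: $U\in\mathbb{C}^{m\times m}$ with $U^*U=I_m$; $Y\in\mathbb{C}^{n\times n}$ with $Y+Y^*=0$; $C\in\mathbb{C}^{m\times n}$ of full rank; and the pair $(Y,C)$ is observable. (iii) If $F(s)$ is a canonical $\mathcal{HP}_\beta$ function, for some $\beta\in(0,1)$, of McMillan degree $n$, then its Hankel singular values are $$\sigma_1=\cdots=\sigma_n=\frac{\sqrt{1-\beta^2}}{\beta}.$$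 (iv) Conversely, if $\Phi(s)$ is an $m\times m$-valued rational function, vanishing at infinity, all of whose $n$ Hankel singular values are equal, then one can always find an $m\times m$ matrix $D$ so that the resulting $D+\Phi(s)$ is a canonical $\mathcal{HP}_\beta$ function for some $\beta\in(0,1)$.
   Context: $\mathbb{C}_R$ denotes the open right half of the complex plane, $\succcurlyeq$ ($\succ$) the positive semidefinite (positive definite) order on Hermitian matrices, and $^*$ the conjugate transpose. For $I_m\succ T\succcurlyeq 0$, an $m\times m$-valued rational function $F(s)$ is in $\mathcal{HP}_T$ if $F(s)+F(s)^*\succcurlyeq T+F(s)^*TF(s)$ for all $s\in\mathbb{C}_R$. It is a canonical $\mathcal{HP}_T$ function if, in addition, $F(s)+F(s)^*-\big(T+F(s)^*TF(s)\big)=0$ for all $s\in i\mathbb{R}$. For $\beta\in[0,1)$, (canonical) $\mathcal{HP}_\beta$ means (canonical) $\mathcal{HP}_T$ with $T=\beta I_m$. An array $R_F=\begin{pmatrix}A&B\\C&D\end{pmatrix}$ with $A$ of size $n\times n$ is a realization of $F(s)=C(sI_n-A)^{-1}B+D$; it is minimal if $n$ is smallest possible (the McMillan degree). A realization is balanced if there is a positive definite $H_o$ with $-(H_oA^*+AH_o)=BB^*$ and $-(H_oA+A^*H_o)=C^*C$ (equal controllability and observability Gramians). The Hankel singular values are the square roots of the eigenvalues of the product of the controllability and observability Gramians of a minimal realization.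
   Formalization: ''C of full rank'' fails in ''only if'' of (i), (ii) (e.g. diag(f,c), f of degree 2, c constant); each is proved without the rank condition, and again with C of full rank on the right and the added left-hand condition that F has a minimal realization with C of full rank. *)

(* Defs.v *)
From HB Require Import structures.
From mathcomp Require Import all_boot all_order all_algebra.
From mathcomp Require Import complex reals.

Set Implicit Arguments.
Unset Strict Implicit.
Unset Printing Implicit Defensive.

Import Order.TTheory GRing.Theory Num.Theory.
Local Open Scope ring_scope.
Local Open Scope sesquilinear_scope.

Section Matrices.
Variable C : numClosedFieldType.

(* In a numClosedFieldType, 0 <= z entails that z is real. *)
Definition psd n (A : 'M[C]_n) : Prop :=
  A^t* = A /\ forall x : 'cV[C]_n, 0 <= (x^t* *m A *m x) 0 0.

Definition posdef n (A : 'M[C]_n) : Prop :=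
  A^t* = A /\ forall x : 'cV[C]_n, x != 0 -> 0 < (x^t* *m A *m x) 0 0.

Definition mxsqrt n (A : 'M[C]_n) : 'M[C]_n :=
  invmx (spectralmx A)
    *m diag_mx (\row_j sqrtC (spectral_diag A 0 j)) *m spectralmx A.

Lemma posdef_psd n (A : 'M[C]_n) : posdef A -> psd A.
Proof.
case=> A_herm A_pos; split=> // x.
have [->|x0] := eqVneq x 0; first by rewrite mulmx0 mxE.
exact: ltW (A_pos x x0).
Qed.

Lemma mxsqrtP n (A : 'M[C]_n) :
  psd A -> psd (mxsqrt A) /\ mxsqrt A *m mxsqrt A = A.
Proof.
move=> [A_herm A_ge0].
set P := spectralmx A; set d := spectral_diag A.
have PU : P \is unitarymx by exact: spectral_unitarymx.
have P1 : P \in unitmx by exact: spectral_unit.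
have PV : invmx P = P^t* by exact: invmx_unitary.
have A_normal : A \is normalmx by apply/normalmxP; rewrite A_herm.
have EA : A = invmx P *m diag_mx d *m P by exact/orthomx_spectralP.
have d_ge0 j : 0 <= d 0 j.
  have := A_ge0 (invmx P *m delta_mx j 0).
  rewrite PV.
  have -> : (P^t* *m (delta_mx j 0 : 'cV[C]_n))^t* = delta_mx 0 j *m P.
    rewrite trmx_mul map_mxM; congr (_ *m _); last exact: trmxCK.
    apply/matrixP=> a b.
    by rewrite !mxE andbC; case: (_ && _); rewrite ?rmorph1 ?rmorph0.
  rewrite -PV {1}EA !mulmxA mulmxK // -!mulmxA mulKVmx // mulmxA.
  rewrite -rowE -colE !mxE eqxx mulr1n.
  by [].
split; last first.
  rewrite /mxsqrt -/P -/d !mulmxA mulmxK // -[_ *m diag_mx _ *m diag_mx _]mulmxA.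
  rewrite mulmx_diag [RHS]EA; congr (_ *m diag_mx _ *m _).
  by apply/rowP=> j; rewrite !mxE -expr2 sqrtCK.
have sd_ge0 j : 0 <= sqrtC (d 0 j) by rewrite sqrtC_ge0.
rewrite /mxsqrt -/P -/d PV; set D := diag_mx _.
have Dstar : D^t* = D.
  apply/matrixP=> i j; rewrite !mxE eq_sym.
  case: eqP => [->|_]; last by rewrite !mulr0n rmorph0.
  by rewrite !mulr1n; apply/CrealP/ger0_real.
have PK : (P^t*)^t* = P by exact: trmxCK.
split; first by rewrite !(trmx_mul, map_mxM) Dstar PK mulmxA.
move=> x; have -> : x^t* *m (P^t* *m D *m P) *m x = (P *m x)^t* *m D *m (P *m x).
  by rewrite trmx_mul map_mxM !mulmxA.
rewrite mul_mx_diag mxE sumr_ge0 // => j _.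
rewrite !mxE mulrAC -normCKC.
by rewrite mulr_ge0 // exprn_ge0.
Qed.

Definition full_rank m n (A : 'M[C]_(m, n)) : Prop := \rank A = minn m n.

Definition observable m n (A : 'M[C]_n) (K : 'M[C]_(m, n)) : Prop :=
  \rank (\mxcol_(k < n) (K *m A ^+ k)) = n.

End Matrices.

Notation "p %:F" := (FracField.tofrac p) : ring_scope.

Section RationalFunctions.
Variable C : numClosedFieldType.
Notation rat_fun := {fraction {poly C}}.
Implicit Types (f : rat_fun) (s : C).

(* [repr f] need not be in lowest terms, hence the division by the gcd. *)
Definition rat_num f : {poly C} :=
  \n_(repr f) %/ gcdp \n_(repr f) \d_(repr f).
Definition rat_den f : {poly C} :=
  \d_(repr f) %/ gcdp \n_(repr f) \d_(repr f).

Definition rat_pole f s : bool := root (rat_den f) s.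
Definition rat_eval f s : C := (rat_num f).[s] / (rat_den f).[s].

Lemma rat_numdenE f : rat_den f != 0 /\ f = (rat_num f)%:F / (rat_den f)%:F.
Proof.
set n := \n_(repr f); set d := \d_(repr f); set g := gcdp n d.
have d0 : d != 0 by exact: denom_ratioP.
have g0 : g != 0 by rewrite gcdp_eq0 negb_and d0 orbT.
have En : n = rat_num f * g by rewrite divpK // dvdp_gcdl.
have Ed : d = rat_den f * g by rewrite divpK // dvdp_gcdr.
have rd0 : rat_den f != 0.
  by apply: contraNneq d0 => rd0; rewrite Ed rd0 mul0r.
split=> //; have Ef : f = n%:F / d%:F.
  apply: (mulIf (x := d%:F)); first by rewrite tofrac_eq0.
  rewrite divfK ?tofrac_eq0 //.
  rewrite /n /d; move: (repr f) (reprK f) => x <-; unlock FracField.tofrac.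
  rewrite -[LHS]FracField.pi_mul; apply/eqmodP.
  rewrite /= FracField.equivfE /FracField.mulf.
  by rewrite !numden_Ratio ?mulf_neq0 ?oner_eq0 ?denom_ratioP // !mulr1 mulrC.
rewrite {1}Ef En Ed !tofracM -mulf_div divff ?mulr1 // tofrac_eq0 //.
Qed.

Lemma rat_evalE (p q : {poly C}) s : q.[s] != 0 ->
  ~~ rat_pole (p%:F / q%:F) s /\ rat_eval (p%:F / q%:F) s = p.[s] / q.[s].
Proof.
move=> qs0; set f := p%:F / q%:F.
have q0 : q != 0 by apply: contraNneq qs0 => ->; rewrite horner0.
have [rd0 Ef] := rat_numdenE f.
have E : p * rat_den f = rat_num f * q.
  apply/eqP; rewrite -tofrac_eq !tofracM -eqr_div ?tofrac_eq0 //.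
  by rewrite -Ef.
have cop : coprimep (rat_den f) (rat_num f).
  rewrite coprimep_sym coprimep_div_gcd // denom_ratioP orbT //.
have ds0 : ~~ rat_pole f s.
  apply: contra qs0; rewrite /rat_pole => rds.
  have : rat_den f %| q.
    by rewrite -(Gauss_dvdpr _ cop) -E dvdp_mull.
  by case/dvdpP=> h ->; rewrite hornerM (eqP rds) mulr0.
split=> //; apply/eqP; rewrite eqr_div //.
by rewrite -!hornerM E mulrC.
Qed.

Definition mx_regular m n (F : 'M[rat_fun]_(m, n)) s : Prop :=
  forall i j, ~~ rat_pole (F i j) s.
Definition mx_eval m n (F : 'M[rat_fun]_(m, n)) s : 'M[C]_(m, n) :=
  map_mx (rat_eval^~ s) F.
Definition mx_const m n (A : 'M[C]_(m, n)) : 'M[rat_fun]_(m, n) :=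
  map_mx (fun a => a%:P%:F) A.
Definition vanishes_at_infinity m n (F : 'M[rat_fun]_(m, n)) : Prop :=
  forall i j, (size (rat_num (F i j)) < size (rat_den (F i j)))%N.

End RationalFunctions.

Notation rat_mx C m := 'M[{fraction {poly C}}]_m.

Section Systems.
Variable C : numClosedFieldType.

(* F(s) + F(s)^* - (T + F(s)^* T F(s)) *)
Definition HP_defect m (T : 'M[C]_m) (F : rat_mx C m) (s : C) : 'M[C]_m :=
  let Fs := mx_eval F s in Fs + Fs^t* - (T + Fs^t* *m T *m Fs).

Definition HP m (T : 'M[C]_m) (F : rat_mx C m) : Prop :=
  forall s : C, 0 < 'Re s -> mx_regular F s /\ psd (HP_defect T F s).

Definition canonical_HP m (T : 'M[C]_m) (F : rat_mx C m) : Prop :=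
  HP T F /\
  forall s : C, 'Re s = 0 -> mx_regular F s /\ HP_defect T F s = 0.

(* C being the field of scalars, K denotes the output matrix, i.e. a realization
   is the array with rows (A, B) and (K, D). *)
Section Realization.
Variables (m n : nat).
Implicit Types (A : 'M[C]_n) (B : 'M[C]_(n, m)) (K : 'M[C]_(m, n)).
Implicit Types (D : 'M[C]_m) (F : rat_mx C m).

Definition realization A B K D F : Prop :=
  F = mx_const K *m invmx ('X%:F%:M - mx_const A) *m mx_const B + mx_const D.

(* With (A, B) controllable, resp. (A, K) observable, such a W exists if and
   only if A is Hurwitz, and it is then unique. *)
Definition ctrl_gramian A B (W : 'M[C]_n) : Prop :=
  posdef W /\ - (W *m A^t* + A *m W) = B *m B^t*.
Definition obs_gramian A K (W : 'M[C]_n) : Prop :=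
  posdef W /\ - (W *m A + A^t* *m W) = K^t* *m K.

Definition balanced A B K : Prop :=
  exists H, ctrl_gramian A B H /\ obs_gramian A K H.

End Realization.

Definition minimal_realization m n (A : 'M[C]_n) (B : 'M[C]_(n, m))
    (K : 'M[C]_(m, n)) (D : 'M[C]_m) (F : rat_mx C m) : Prop :=
  realization A B K D F /\
  forall k (A' : 'M[C]_k) (B' : 'M[C]_(k, m)) (K' : 'M[C]_(m, k)) (D' : 'M[C]_m),
    realization A' B' K' D' F -> (n <= k)%N.

Definition mcmillan_degree m (F : rat_mx C m) (n : nat) : Prop :=
  exists (A : 'M[C]_n) (B : 'M[C]_(n, m)) (K : 'M[C]_(m, n)) (D : 'M[C]_m),
    minimal_realization A B K D F.

(* The list sigma, up to order. The matrices Wc *m Wo of two minimal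
   realizations are similar, so "every" could be replaced by "some". *)
Definition hankel_singular_values m (F : rat_mx C m) n (sigma : 'I_n -> C) :
    Prop :=
  [/\ forall i, 0 <= sigma i,
      mcmillan_degree F n &
      forall (A : 'M[C]_n) (B : 'M[C]_(n, m)) (K : 'M[C]_(m, n)) (D : 'M[C]_m),
        minimal_realization A B K D F ->
        exists Wc Wo : 'M[C]_n,
          [/\ ctrl_gramian A B Wc, obs_gramian A K Wo &
              char_poly (Wc *m Wo) = \prod_i ('X - (sigma i ^+ 2)%:P)]].

(* A property of F, since the output matrices of two minimal realizations
   differ by an invertible right factor. A canonical HP function need not have
   it: for m = 2 take diag(f, c) with f scalar of degree 2 and c constant; the
   output matrices of its minimal realizations are 2 x 2 with zero second
   row. *)
Definition full_rank_output m (F : rat_mx C m) : Prop :=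
  exists n (A : 'M[C]_n) (B : 'M[C]_(n, m)) (K : 'M[C]_(m, n)) (D : 'M[C]_m),
    minimal_realization A B K D F /\ full_rank K.

End Systems.

(* Main.v *)
Require Import Defs.
From mathcomp Require Import all_boot all_order all_algebra.
From mathcomp Require Import complex boolp reals ring.

Set Implicit Arguments.
Unset Strict Implicit.
Unset Printing Implicit Defensive.

Import Order.TTheory GRing.Theory Num.Theory.
Local Open Scope ring_scope.
Local Open Scope sesquilinear_scope.

(* Let (A, B, K, D) be any minimal realization of a canonical HP_T function F.
   As F is regular on the closed right half plane, A is Hurwitz, and
   observability yields P > 0 with A^* P + P A = - K^* T K.  With
   X = (s - A)^-1 B and M = K - D^* T K - B^* P, the defect at s is
     (D + D^* - T - D^* T D) + (M X + X^* M^* ) + 2 Re s X^* P X.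
   It vanishes on the imaginary axis, where X^* = - B^* (s + A^* )^-1.  Hence
   the Markov parameters satisfy M A^k B = B^* (- A^* )^k M^*; applying the
   characteristic polynomial of - A^*, controllability and the disjointness of
   the spectra of A and - A^* force M = 0.  Conversely P B = K^* (1 - T D) and
   D + D^* = T + D^* T D reduce the defect to 2 Re s X^* P X.  A change of
   state coordinates by the square root of P gives the normal forms, and for
   T = beta I the two Gramians are multiples of P and of its inverse. *)

(** The scalars form an arbitrary algebraically closed numeric field, so each analytic argument is
    replaced by an algebraic one. Positivity of [P] comes from a unitary triangularization and Schur
    complements instead of an integral of matrix exponentials; an identity along the imaginary axis
    is tested at the natural multiples of ['i], which are infinitely many; growth at infinity
    becomes a comparison of degrees. Minimality only speaks of the dimension [n], so observability,
    controllability and the absence of cancelled poles have to be derived from it, and [F] must be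
    shown proper before it has any realization. For [T = beta I] the Gramians are [P / beta] and
    [(1 - beta^2) / beta] times the inverse of [P]; their product is the scalar
    [(1 - beta^2) / beta^2], which is (iii). For (iv) the equation
    [sigma = sqrt (1 - beta^2) / beta] is solved by [beta = 1 / sqrt (1 + sigma^2)], and the
    equality of two Gram matrices provides the unitary matrix out of which [D] is built. *)

Section Realizations.
Variable C : numClosedFieldType.
Local Notation RF := {fraction {poly C}}.
Local Notation toF := (@FracField.tofrac {poly C}).
Local Notation "\s- A" := ('X%:F%:M - mx_const A : 'M[RF]__)
  (at level 35, A at level 30).

(** * Resolvents over the field of fractions and Markov parameters *)

Lemma mx_constE m n (A : 'M[C]_(m, n)) : mx_const A = map_mx (toF \o polyC) A.
Proof. by []. Qed.

Lemma map_tofrac_inj m n : injective (map_mx toF : 'M_(m, n) -> 'M_(m, n)).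
Proof.
move=> A B /matrixP E; apply/matrixP => i j; have := E i j.
by rewrite !mxE => /eqP; rewrite tofrac_eq => /eqP.
Qed.

Lemma mx_constM m n p (A : 'M[C]_(m, n)) (B : 'M[C]_(n, p)) :
  mx_const (A *m B) = mx_const A *m mx_const B.
Proof. by rewrite !mx_constE map_mxM. Qed.

Lemma mx_constD m n (A B : 'M[C]_(m, n)) :
  mx_const (A + B) = mx_const A + mx_const B.
Proof. by rewrite !mx_constE map_mxD. Qed.

Lemma mx_constB m n (A B : 'M[C]_(m, n)) :
  mx_const (A - B) = mx_const A - mx_const B.
Proof. by rewrite !mx_constE map_mxB. Qed.

Lemma mx_const0 m n : mx_const (0 : 'M[C]_(m, n)) = 0.
Proof. by rewrite !mx_constE map_mx0. Qed.

Lemma mx_const1 n : mx_const (1%:M : 'M[C]_n) = 1%:M.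
Proof. by rewrite !mx_constE map_mx1. Qed.

Lemma mx_const_scalar n (a : C) : mx_const (a%:M : 'M[C]_n) = a%:P%:F%:M.
Proof. by rewrite mx_constE map_scalar_mx. Qed.

Lemma trmx_const m n (A : 'M[C]_(m, n)) : (mx_const A)^T = mx_const A^T.
Proof. by rewrite !mx_constE map_trmx. Qed.

Lemma char_mxE n (A : 'M[C]_n) : \s- A = map_mx toF (char_poly_mx A).
Proof.
rewrite /char_poly_mx map_mxB map_scalar_mx mx_constE -map_mx_comp.
by congr (_ - _); apply/matrixP => i j; rewrite !mxE.
Qed.

Lemma char_poly_neq0 n (A : 'M[C]_n) : char_poly A != 0.
Proof. exact: monic_neq0 (char_poly_monic A). Qed.

Lemma char_mx_unit n (A : 'M[C]_n) : \s- A \in unitmx.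
Proof. by rewrite unitmxE char_mxE det_map_mx unitfE tofrac_eq0 char_poly_neq0. Qed.

(** Replaces the inverse of [s - A] by a solution [X] of a linear equation, so that later arguments
    can stay with polynomial identities. *)
Lemma realizationP m n (A : 'M[C]_n) (B : 'M[C]_(n, m)) K D F :
  realization A B K D F <->
  exists2 X, \s- A *m X = mx_const B & F = mx_const K *m X + mx_const D.
Proof.
split=> [->|[X EX ->]].
  exists (invmx (\s- A) *m mx_const B); last by rewrite mulmxA.
  by rewrite mulKVmx ?char_mx_unit.
by rewrite /realization -mulmxA -EX mulKmx ?char_mx_unit.
Qed.

Lemma char_mx_adj n p (A : 'M[C]_n) (B : 'M[C]_(n, p)) X :
  \s- A *m X = mx_const B ->
  (char_poly A)%:F *: X = map_mx toF (\adj (char_poly_mx A) *m map_mx polyC B).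
Proof.
move=> EX; rewrite map_mxM map_mx_adj -char_mxE -map_mx_comp -mx_constE -EX.
by rewrite mulmxA mul_adj_mx char_mxE det_map_mx mul_scalar_mx.
Qed.

Lemma size_adj_char_poly_mx n (A : 'M[C]_n) i j :
  (size (\adj (char_poly_mx A) i j) <= n)%N.
Proof.
rewrite !mxE expand_cofactor; apply: leq_trans (size_sum _ _ _) _.
apply/bigmax_leqP => s _; rewrite size_Msign.
case: n => [|n] in A i j s *; first by case: i.
apply: leq_trans (size_poly_prod_leq _ _) _ => /=.
have card : #|[pred k | j != k]| = n.
  rewrite -[RHS]/(n.+1.-1) -[in RHS](card_ord n.+1) -(cardC1 j).
  by apply: eq_card => k; rewrite !inE eq_sym.
rewrite card leq_subLR -addSnnS.
apply: (@leq_ltn_trans (\sum_(k < n.+1 | j != k) 2)%N).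
  apply: leq_sum => k _; rewrite !mxE.
  by case: eqP => _; rewrite ?mulr1n ?mulr0n ?sub0r ?size_XsubC // size_polyN
    (leq_trans (size_polyC_leq1 _)).
by rewrite sum_nat_const card muln2 -addnn addSn.
Qed.

(** [K (s - A)^-1 B] is strictly proper: by Cramer's rule its product with [char_poly A] has entries
    of degree below [n], whereas a nonzero entry of [N] would give degree at least [n]. *)
Lemma poly_transfer_eq0 m n p (A : 'M[C]_n) (B : 'M[C]_(n, p))
    (K : 'M[C]_(m, n)) X N :
  \s- A *m X = mx_const B -> mx_const K *m X = map_mx toF N -> N = 0.
Proof.
move=> EX EN.
have E : char_poly A *: N = map_mx polyC K *m \adj (char_poly_mx A) *m
    map_mx polyC B.
  apply: map_tofrac_inj; rewrite -mulmxA map_mxM map_mxZ -EN -(char_mx_adj EX).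
  by rewrite -map_mx_comp -mx_constE -scalemxAr.
apply/matrixP => i j; rewrite [RHS]mxE; apply/eqP; apply: contraT => N0.
have := congr1 (fun M : 'M[{poly C}]_(m, p) => size (M i j)) E.
rewrite mxE size_monicM ?char_poly_monic // size_char_poly => /eqP.
rewrite eqn_leq => /andP[+ _].
rewrite addSn /= leqNgt => /negP[]; apply: leq_ltn_trans (_ : n < _)%N; last first.
  by rewrite -addn1 leq_add2l size_poly_gt0.
rewrite mxE (leq_trans (size_sum _ _ _)) //; apply/bigmax_leqP => k _.
rewrite !mxE mulrC mul_polyC (leq_trans (size_scale_leq _ _)) //.
rewrite (leq_trans (size_sum _ _ _)) //; apply/bigmax_leqP => l _.
rewrite [map_mx _ _ _ _]mxE mul_polyC (leq_trans (size_scale_leq _ _)) //.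
exact: size_adj_char_poly_mx.
Qed.

(** Once [K X] is polynomial it is zero, hence [K A X = s K X - K B] is the constant [- K B]. It
    follows that [K B = 0] and [K A X = 0], and the argument repeats with [K A] for [K]. *)
Lemma poly_transfer_markov m n p (A : 'M[C]_n) (B : 'M[C]_(n, p))
    (K : 'M[C]_(m, n)) X N :
  \s- A *m X = mx_const B -> mx_const K *m X = map_mx toF N ->
  forall k, K *m A ^+ k *m B = 0.
Proof.
move=> EX EN k.
have KX0 : mx_const K *m X = 0.
  by rewrite EN (poly_transfer_eq0 EX EN) map_mx0.
elim: k K KX0 {N EN} => [|k IHk] K KX0; rewrite ?expr0 ?exprS ?mulmxA.
  all: have E : mx_const (K *m A) *m X = map_mx toF (- map_mx polyC (K *m B));
    first by rewrite map_mxN -map_mx_comp -mx_constE !mx_constM -EX mulmxA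
      mulmxBr mulmxBl opprB scalar_mxC -!mulmxA KX0 mulmx0 subr0.
  rewrite mulmx1; have := poly_transfer_eq0 EX E.
  by move=> /eqP; rewrite oppr_eq0 => /eqP; rewrite -(map_mx0 polyC) => /map_mx_inj.
apply: IHk.
by rewrite E (poly_transfer_eq0 EX E) map_mx0.
Qed.

(** Matrix version of the divisibility of [p - p(a)] by [X - a]; the quotient [E] follows the Horner
    scheme. *)
Lemma char_mx_dvd_horner n (A : 'M[C]_n.+1) (p : {poly C}) :
  exists E, p%:M - map_mx polyC (horner_mx A p) = char_poly_mx A *m E.
Proof.
elim/poly_ind: p => [|p c [E IH]].
  exists 0; rewrite mulmx0 (raddf0 (horner_mx A)) map_mx0 subr0.
  by rewrite raddf0.
exists ('X *: E + map_mx polyC (horner_mx A p)).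
have -> : horner_mx A (p * 'X + c%:P) = horner_mx A p *m A + c%:M.
  by rewrite rmorphD rmorphM /= horner_mx_C horner_mx_X.
rewrite map_mxD map_mxM map_scalar_mx.
rewrite [in LHS]raddfD /= [p * 'X]mulrC opprD addrACA subrr addr0.
rewrite mulmxDr -scalemxAr -IH scalerBr scale_scalar_mx -addrA; congr (_ + _).
rewrite /char_poly_mx mulmxBl mul_scalar_mx addrA [- _ + _]addrC subrr sub0r.
by rewrite -!map_mxM; congr (- map_mx _ _); exact: comm_horner_mx.
Qed.

(** Since [d - d(A) = (s - A) E], subtracting the polynomial matrix [E B] from [d X] leaves the
    resolvent solution for the input [d(A) B]. If [d K X] is polynomial, the Markov parameters with
    that input therefore vanish. *)
Lemma poly_multiple_transfer m n p (A : 'M[C]_n.+1) (B : 'M[C]_(n.+1, p))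
    (K : 'M[C]_(m, n.+1)) X (d : {poly C}) N :
  \s- A *m X = mx_const B -> d%:F *: (mx_const K *m X) = map_mx toF N ->
  forall k, K *m A ^+ k *m (horner_mx A d *m B) = 0.
Proof.
move=> EX EN; have [E HE] := char_mx_dvd_horner A d.
set X' := d%:F *: X - map_mx toF (E *m map_mx polyC B).
apply: (@poly_transfer_markov _ _ _ _ _ _ X'
  (N - map_mx polyC K *m E *m map_mx polyC B)).
  rewrite mulmxBr -scalemxAr EX char_mxE -map_mxM mulmxA -HE mulmxBl map_mxB.
  rewrite -map_mxM -map_mx_comp -mx_constE [X in _ - (X - _)]map_mxM.
  by rewrite map_scalar_mx mul_scalar_mx -map_mx_comp -mx_constE opprB addrC subrK.
rewrite mulmxBr -scalemxAr EN map_mxB -mulmxA [in RHS]map_mxM.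
by rewrite -map_mx_comp -mx_constE.
Qed.

(** * Observability, controllability and minimality *)

Lemma observable_inj m n (A : 'M[C]_n) (K : 'M[C]_(m, n)) :
  observable A K ->
  forall p (x : 'M_(n, p)), (forall k, K *m A ^+ k *m x = 0) -> x = 0.
Proof.
move=> rkO p x Kx0; set O := \mxcol_(k < n) (K *m A ^+ k) in rkO *.
have /row_fullP[L LO] : row_full O by rewrite /row_full rkO.
rewrite -[x]mul1mx -LO -mulmxA [O *m x]mxcol_mul.
rewrite (_ : mxcol _ = 0) ?mulmx0 //; apply/mxcolP => k.
by rewrite mxcolK submxcol0.
Qed.

(** By Cayley-Hamilton each power of [A] is a combination of the powers below [n], the only ones in
    the observability matrix. *)
Lemma observable_kernel m n (A : 'M[C]_n) (K : 'M[C]_(m, n)) p (x : 'M_(n, p)) :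
  (\mxcol_(k < n) (K *m A ^+ k)) *m x = 0 -> forall k, K *m A ^+ k *m x = 0.
Proof.
move=> Ox0 k.
have Kx0 (i : 'I_n) : K *m A ^+ i *m x = 0.
  by move: Ox0; rewrite mxcol_mul -(mxcol0 _ ) => /eq_mxcolP.
case: n => [|n] in A K x Ox0 Kx0 *; first by rewrite [x]flatmx0 mulmx0.
set r := 'X^k %% char_poly A.
have -> : A ^+ k = horner_mx A r.
  rewrite -{1}(horner_mx_X A) -rmorphXn /= (divp_eq 'X^k (char_poly A)).
  by rewrite rmorphD rmorphM /= Cayley_Hamilton mulr0 add0r.
rewrite -[r]coefK poly_def rmorph_sum /= mulmx_sumr mulmx_suml big1 // => i _.
have lt_in : (i < n.+1)%N.
  rewrite (leq_trans (ltn_ord i)) // -ltnS -(size_char_poly A).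
  by rewrite ltn_modp char_poly_neq0.
rewrite linearZ /= rmorphXn /= horner_mx_X -scalemxAr -scalemxAl.
by rewrite (Kx0 (Ordinal lt_in)) scaler0.
Qed.

Lemma inj_observable m n (A : 'M[C]_n) (K : 'M[C]_(m, n)) :
  (forall x : 'M_n, (forall k, K *m A ^+ k *m x = 0) -> x = 0) -> observable A K.
Proof.
move=> inj; rewrite /observable; set O := mxcol _.
have : cokermx O == 0.
  by apply/eqP/inj/observable_kernel; rewrite mulmx_coker.
by rewrite cokermx_eq0 => /eqP.
Qed.

(** [E] sends the old state to the new one. It will be a basis of the row space of the observability
    matrix when the state is compressed, and an invertible matrix when coordinates are changed. *)
Lemma realization_reduce m n r (A : 'M[C]_n) (B : 'M[C]_(n, m)) (K1 : 'M[C]_(m, r))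
    (A1 : 'M[C]_r) (E : 'M[C]_(r, n)) D F :
  E *m A = A1 *m E -> realization A B (K1 *m E) D F ->
  realization A1 (E *m B) K1 D F.
Proof.
move=> EA /realizationP[X EX ->]; apply/realizationP; exists (mx_const E *m X).
  rewrite mulmxA mulmxBl -mx_constM -EA mx_constM -scalar_mxC -mulmxBr -mulmxA EX.
  by rewrite mx_constM.
by rewrite mx_constM mulmxA.
Qed.

(** The row space of the observability matrix contains the rows of [K] and is stable under [A]. A
    basis of it carries a realization whose dimension is the rank, so minimality bounds [n] by that
    rank. *)
Lemma minimal_observable m n (A : 'M[C]_n) (B : 'M[C]_(n, m)) K D F :
  minimal_realization A B K D F -> observable A K.
Proof.
move=> [rF min]; rewrite /observable; set O := mxcol _.
have OV k : K *m A ^+ k *m cokermx O = 0.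
  by apply: observable_kernel; rewrite mulmx_coker.
apply/eqP; rewrite eqn_leq rank_leq_col /=.
have /submxP[K1 EK] : (K <= row_base O)%MS.
  by rewrite eq_row_base submxE; have := OV 0; rewrite expr0 mulmx1 => ->.
have /submxP[A1 EA] : (row_base O *m A <= row_base O)%MS.
  rewrite eq_row_base (submx_trans (_ : _ <= O *m A)%MS) ?submxMr ?eq_row_base //.
  rewrite submxE -mulmxA mxcol_mul (_ : mxcol _ = 0) //; apply/mxcolP => k.
  by rewrite mxcolK submxcol0; have := OV k.+1; rewrite exprSr !mulmxA => ->.
by move: rF; rewrite EK => /(realization_reduce EA) /min.
Qed.

Lemma realization_tr m n (A : 'M[C]_n) (B : 'M[C]_(n, m)) K D F :
  realization A B K D F -> realization A^T K^T B^T D^T F^T.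
Proof.
rewrite /realization => ->; rewrite linearD /= !trmx_mul trmx_inv linearB /=.
by rewrite tr_scalar_mx !trmx_const mulmxA.
Qed.

Lemma minimal_tr m n (A : 'M[C]_n) (B : 'M[C]_(n, m)) K D F :
  minimal_realization A B K D F -> minimal_realization A^T K^T B^T D^T F^T.
Proof.
move=> [rF min]; split; first exact: realization_tr.
move=> k A' B' K' D' /realization_tr; rewrite trmxK; exact: min.
Qed.

Lemma trmxX n (A : 'M[C]_n) k : (A ^+ k)^T = A^T ^+ k.
Proof. by elim: k => [|k IHk]; rewrite ?expr0 ?trmx1 // exprS exprSr trmx_mul IHk. Qed.

(** Observability of the transposed realization, put as a cancellation law. *)
Lemma minimal_controllable m n (A : 'M[C]_n) (B : 'M[C]_(n, m)) K D F :
  minimal_realization A B K D F ->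
  forall p (M : 'M_(p, n)), (forall k, M *m A ^+ k *m B = 0) -> M = 0.
Proof.
move=> /minimal_tr/minimal_observable/observable_inj obs p M MB0.
apply: (can_inj trmxK); rewrite trmx0; apply: obs => k.
by rewrite -trmxX -!trmx_mul mulmxA MB0 trmx0.
Qed.

(** * Existence of realizations for proper rational matrices *)

Definition realizable m p (F : 'M[RF]_(m, p)) : Prop :=
  exists n (A : 'M[C]_n) (B : 'M[C]_(n, p)) (K : 'M[C]_(m, n)) (D : 'M[C]_(m, p)) X,
    \s- A *m X = mx_const B /\ F = mx_const K *m X + mx_const D.

Lemma realizable_const m p (D : 'M[C]_(m, p)) : realizable (mx_const D).
Proof.
exists 0, 0, 0, 0, D, 0; split; first by rewrite [LHS]flatmx0 [RHS]flatmx0.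
by rewrite mulmx0 add0r.
Qed.

Lemma char_mx_block n1 n2 (A : 'M[C]_n1) (B : 'M[C]_(n1, n2)) (D : 'M[C]_n2) :
  \s- (block_mx A B 0 D) = block_mx (\s- A) (- mx_const B) 0 (\s- D).
Proof.
rewrite [mx_const (block_mx _ _ _ _)]map_block_mx scalar_mx_block opp_block_mx.
by rewrite add_block_mx -!/(mx_const _) mx_const0 oppr0 addr0 add0r.
Qed.

Lemma realizable_add m p (F G : 'M[RF]_(m, p)) :
  realizable F -> realizable G -> realizable (F + G).
Proof.
move=> [n1 [A1 [B1 [K1 [D1 [X1 [E1 ->]]]]]]] [n2 [A2 [B2 [K2 [D2 [X2 [E2 ->]]]]]]].
exists (n1 + n2)%N, (block_mx A1 0 0 A2), (col_mx B1 B2), (row_mx K1 K2), (D1 + D2).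
exists (col_mx X1 X2); split.
  rewrite char_mx_block mul_block_col mx_const0 oppr0 !mul0mx addr0 add0r E1 E2.
  by rewrite [RHS]map_col_mx.
by rewrite [mx_const (row_mx _ _)]map_row_mx mul_row_col mx_constD addrACA.
Qed.

(** Cascade connection: the output of [G] drives [F], whence the coupling block [B1 K2]. *)
Lemma realizable_mul m p q (F : 'M[RF]_(m, p)) (G : 'M[RF]_(p, q)) :
  realizable F -> realizable G -> realizable (F *m G).
Proof.
move=> [n1 [A1 [B1 [K1 [D1 [X1 [E1 ->]]]]]]] [n2 [A2 [B2 [K2 [D2 [X2 [E2 ->]]]]]]].
exists (n1 + n2)%N, (block_mx A1 (B1 *m K2) 0 A2), (col_mx (B1 *m D2) B2).
exists (row_mx K1 (D1 *m K2)), (D1 *m D2).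
exists (col_mx (X1 *m (mx_const K2 *m X2 + mx_const D2)) X2); split.
  rewrite char_mx_block mul_block_col mul0mx add0r E2 mulmxA E1 [RHS]map_col_mx.
  congr col_mx; rewrite -!/(mx_const _) !mx_constM mulmxDr mulNmx mulmxA.
  by rewrite addrC addrA addNr add0r.
rewrite [mx_const (row_mx _ _)]map_row_mx mul_row_col -!/(mx_const _) !mx_constM.
by rewrite mulmxDl -addrA -mulmxA [X in _ + X = _]mulmxDr !mulmxA.
Qed.

Lemma realizable_inv_linear (a : C) : realizable (('X - a%:P)%:F^-1%:M : 'M[RF]_1).
Proof.
exists 1%N, a%:M, 1%:M, 1%:M, 0, (('X - a%:P)%:F^-1%:M); split; last first.
  by rewrite mx_const1 mul1mx mx_const0 addr0.
rewrite char_mxE /char_poly_mx map_scalar_mx -raddfB map_scalar_mx -scalar_mxM.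
by rewrite mx_const1 divff // tofrac_eq0 polyXsubC_eq0.
Qed.

(** Induction on the degree of [q]. Dividing a root [a] out of [q] and writing
    [p = p' (X - a) + p(a)] gives [p / q = p' / q' + (X - a)^-1 (p(a) / q')], built from realizable
    functions by a sum and a product. *)
Lemma realizable_proper (p q : {poly C}) : q != 0 -> (size p <= size q)%N ->
  realizable ((p%:F / q%:F)%:M : 'M[RF]_1).
Proof.
elim: {q}_.+1 {-2}q (ltnSn (size q)) p => // N IH q; rewrite ltnS => szq p q0 szp.
have [/size1_polyC Eq|sz1] := leqP (size q) 1.
  have Ep : p = (p`_0)%:P.
    by apply/size1_polyC/(leq_trans szp); rewrite Eq size_polyC_leq1.
  have q00 : q`_0 != 0 by apply: contraNneq q0 => E; rewrite Eq E.
  rewrite (_ : _%:M = mx_const (p`_0 / q`_0)%:M); first exact: realizable_const.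
  rewrite mx_const_scalar Eq Ep !coefC /= polyCM tofracM; congr (_ * _)%:M.
  apply: (mulfI (x := (q`_0)%:P%:F)); first by rewrite tofrac_eq0 polyC_eq0.
  by rewrite divff ?tofrac_eq0 ?polyC_eq0 // -tofracM -polyCM divff.
have [|a /factor_theorem[q' Eq]] := closed_rootP q _; first by rewrite neq_ltn sz1 orbT.
have [p' Ep] : exists p', p = p' * ('X - a%:P) + p.[a]%:P.
  have /factor_theorem[p' E] : root (p - p.[a]%:P) a by rewrite /root !hornerE subrr.
  by exists p'; rewrite -E subrK.
have q'0 : q' != 0 by apply: contraNneq q0 => E; rewrite Eq E mul0r.
have szM r : r != 0 -> size (r * ('X - a%:P)) = (size r).+1.
  by move=> r0; rewrite size_Mmonic ?monicXsubC // size_XsubC addn2.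
have szq' : size q = (size q').+1 by rewrite Eq szM.
have Xa : ('X - a%:P)%:F != 0 by rewrite tofrac_eq0 polyXsubC_eq0.
have szp' : (size p' <= size q')%N.
  have [->|p'0] := eqVneq p' 0; first by rewrite size_poly0.
  rewrite -ltnS -szq'; apply: leq_trans szp; rewrite Ep size_polyDl ?szM //.
  by rewrite (leq_ltn_trans (size_polyC_leq1 _)) // ltnS size_poly_gt0.
rewrite (_ : _%:M = (p'%:F / q'%:F)%:M +
   ('X - a%:P)%:F^-1%:M *m (p.[a]%:P%:F / q'%:F)%:M).
  apply: realizable_add; first by apply: IH; rewrite // -szq'.
  apply: realizable_mul; first exact: realizable_inv_linear.
  apply: IH; rewrite // -?szq' // (leq_trans (size_polyC_leq1 _)) //.
  by rewrite size_poly_gt0.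
rewrite -scalar_mxM -raddfD; congr _%:M.
rewrite {1}Ep Eq !tofracM tofracD tofracM mulrDl.
rewrite -mulf_div divff // mulr1; congr (_ + _).
by rewrite invfM mulrA mulrC.
Qed.

(** Each entry is put in its place by a column on the left and a row on the right, which is why
    [realizable] admits rectangular matrices. *)
Lemma realizable_proper_mx m p (F : 'M[RF]_(m, p)) :
  (forall i j, (size (rat_num (F i j)) <= size (rat_den (F i j)))%N) -> realizable F.
Proof.
move=> szF; rewrite (_ : F = \sum_i \sum_j mx_const (delta_mx i 0) *m (F i j)%:M
   *m mx_const (delta_mx (0 : 'I_1) j)).
  have sum_r (I : finType) (G : I -> 'M[RF]_(m, p)) :
      (forall i, realizable (G i)) -> realizable (\sum_i G i).
    move=> rG; elim/big_ind: _ => [||i _]; last exact: rG.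
      by rewrite -(mx_const0 m p); exact: realizable_const.
    exact: realizable_add.
  apply: (sum_r) => i; apply: (sum_r) => j.
  apply: realizable_mul; last exact: realizable_const.
  apply: realizable_mul; first exact: realizable_const.
  have [d0 ->] := rat_numdenE (F i j); exact: realizable_proper.
rewrite {1}[F]matrix_sum_delta; apply: eq_bigr => i _; apply: eq_bigr => j _.
rewrite mul_mx_scalar -scalemxAl -mx_constM mul_delta_mx; congr (_ *: _).
by apply/matrixP => a b; rewrite !mxE; case: andP; rewrite ?tofrac0 ?tofrac1.
Qed.

Lemma proper_minimal_realization m (F : 'M[RF]_m) :
  (forall i j, (size (rat_num (F i j)) <= size (rat_den (F i j)))%N) ->
  exists n (A : 'M[C]_n) (B : 'M[C]_(n, m)) (K : 'M[C]_(m, n)) (D : 'M[C]_m),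
    minimal_realization A B K D F.
Proof.
move=> /realizable_proper_mx[n0 [A0 [B0 [K0 [D0 [X0 [E0 EF]]]]]]].
pose P n := `[< exists (A : 'M[C]_n) (B : 'M[C]_(n, m)) (K : 'M[C]_(m, n)) (D : 'M[C]_m),
   realization A B K D F >].
have exP : exists n, P n.
  exists n0; apply/asboolP; exists A0, B0, K0, D0; apply/realizationP; by exists X0.
case: (ex_minnP exP) => n /asboolP[A [B [K [D rF]]]] min.
exists n, A, B, K, D; split=> // k A' B' K' D' rF'.
by apply: min; apply/asboolP; exists A', B', K', D'.
Qed.

(** * Evaluation at points, poles and eigenvalues *)

Lemma root_char_poly n (A : 'M[C]_n) s : root (char_poly A) s = (s%:M - A \notin unitmx).
Proof.
rewrite unitmxE unitfE negbK /root /char_poly -horner_evalE -det_map_mx /char_poly_mx.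
rewrite map_mxB map_scalar_mx /= horner_evalE hornerX -map_mx_comp.
by rewrite (_ : map_mx _ A = A) //; apply/matrixP => i j; rewrite !mxE /= horner_evalE hornerC.
Qed.

Lemma horner_adj n (A : 'M[C]_n) s :
  map_mx (horner_eval s) (\adj (char_poly_mx A)) = \adj (s%:M - A).
Proof.
rewrite map_mx_adj /char_poly_mx map_mxB map_scalar_mx /= horner_evalE hornerX.
rewrite -map_mx_comp; congr (\adj (_ - _)).
by apply/matrixP => i j; rewrite !mxE /= horner_evalE hornerC.
Qed.

Lemma horner_map_polyC m n (A : 'M[C]_(m, n)) s :
  map_mx (horner_eval s) (map_mx polyC A) = A.
Proof. by apply/matrixP => i j; rewrite !mxE /= horner_evalE hornerC. Qed.

Lemma horner_char_poly n (A : 'M[C]_n) s : (char_poly A).[s] = \det (s%:M - A).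
Proof.
rewrite /char_poly -horner_evalE -det_map_mx /char_poly_mx.
by rewrite map_mxB map_scalar_mx /= horner_evalE hornerX horner_map_polyC.
Qed.

(** The entries are fractions over [char_poly A], which does not vanish at [s]; [rat_evalE]
    evaluates them although they need not be in lowest terms. *)
Lemma realization_eval m n (A : 'M[C]_n) (B : 'M[C]_(n, m)) K D F s :
  realization A B K D F -> s%:M - A \in unitmx ->
  mx_regular F s /\ mx_eval F s = K *m invmx (s%:M - A) *m B + D.
Proof.
move=> /realizationP[X EX ->] As.
have chi0 : (char_poly A).[s] != 0 by rewrite horner_char_poly -unitfE -unitmxE.
pose N := map_mx polyC K *m \adj (char_poly_mx A) *m map_mx polyC B
   + char_poly A *: map_mx polyC D.
have EN i j : (mx_const K *m X + mx_const D) i j = (N i j)%:F / (char_poly A)%:F.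
  have c0 : (char_poly A)%:F != 0 by rewrite tofrac_eq0 char_poly_neq0.
  apply: (mulIf c0); rewrite divfK // mulrC.
  have <- : map_mx toF N i j = (N i j)%:F by rewrite mxE.
  rewrite map_mxD map_mxZ -mulmxA map_mxM -(char_mx_adj EX) -!map_mx_comp -!mx_constE.
  by rewrite -scalemxAr -scalerDr [RHS]mxE.
split=> [i j|]; first by rewrite EN; case: (rat_evalE (N i j) chi0).
apply/matrixP => i j; rewrite mxE EN; have [_ ->] := rat_evalE (N i j) chi0.
have -> : (N i j).[s] = map_mx (horner_eval s) N i j by rewrite [RHS]mxE.
rewrite map_mxD !map_mxM map_mxZ horner_adj !horner_map_polyC /= horner_evalE.
rewrite /invmx As -horner_char_poly -scalemxAr -scalemxAl !mxE mulrDl.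
by rewrite mulrC [_ * D _ _]mulrC mulfK.
Qed.

Lemma poly_eq0_inf (p : {poly C}) (f : nat -> C) :
  injective f -> (forall k, p.[f k] = 0) -> p = 0.
Proof.
move=> f_inj pf0; apply/eqP; apply: contraT => p0.
have := max_poly_roots p0 (rs := [seq f k | k <- iota 0 (size p)]).
rewrite size_map size_iota ltnn; apply.
  by apply/allP => _ /mapP[k _ ->]; rewrite /root pf0.
by rewrite map_inj_uniq ?iota_uniq.
Qed.

(** After clearing denominators, a polynomial identity holds at infinitely many points, hence
    everywhere: the transfer function is the constant [N]. Being strictly proper it is zero, and so
    are its Markov parameters. *)
Lemma eval_markov m n p (A : 'M[C]_n) (B : 'M[C]_(n, p)) (K : 'M[C]_(m, n)) N
    (f : nat -> C) : injective f ->
  (forall k, (f k)%:M - A \in unitmx) ->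
  (forall k, K *m invmx ((f k)%:M - A) *m B = N) ->
  N = 0 /\ forall k, K *m A ^+ k *m B = 0.
Proof.
move=> f_inj Af Nf.
set X := invmx (\s- A) *m mx_const B.
have EX : \s- A *m X = mx_const B by rewrite mulKVmx ?char_mx_unit.
have E : map_mx polyC K *m \adj (char_poly_mx A) *m map_mx polyC B
   = char_poly A *: map_mx polyC N.
  apply/matrixP => i j; apply/eqP; rewrite -subr_eq0; apply/eqP.
  apply: (poly_eq0_inf f_inj) => k; apply/eqP; rewrite hornerD hornerN subr_eq0.
  have mapE (M : 'M[{poly C}]_(m, p)) : (M i j).[f k] = map_mx (horner_eval (f k)) M i j.
    by rewrite [RHS]mxE.
  rewrite !mapE !map_mxM map_mxZ horner_adj !horner_map_polyC /= horner_evalE.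
  rewrite -(Nf k) /invmx Af -scalemxAr -scalemxAl scalerA -horner_char_poly divff ?scale1r //.
  by rewrite horner_char_poly -unitfE -unitmxE.
have KX : mx_const K *m X = map_mx toF (map_mx polyC N).
  have c0 : (char_poly A)%:F != 0 by rewrite tofrac_eq0 char_poly_neq0.
  apply: (scalerI c0); rewrite scalemxAr (char_mx_adj EX) -map_mxZ -E.
  by rewrite -mulmxA [in RHS]map_mxM -map_mx_comp.
split; last exact: poly_transfer_markov KX.
have /eqP := poly_transfer_eq0 EX KX.
by rewrite -(map_mx0 polyC) => /eqP /map_mx_inj.
Qed.

Lemma eigenvalue_char_root n (A : 'M[C]_n) s :
  s%:M - A \notin unitmx -> exists2 x : 'cV_n, x != 0 & A *m x = s *: x.
Proof.
rewrite -root_char_poly => rt.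
have : root (char_poly A^T) s.
  by move: rt; rewrite !root_char_poly -[_ - A^T]trmxK unitmx_tr linearB /= trmxK tr_scalar_mx.
case: n => [|n] in A rt *.
  by move=> _; move: rt; rewrite root_char_poly unitmxE det_mx00 unitr1.
rewrite -eigenvalue_root_char => /eigenvalueP[v vA v0].
exists v^T; first by rewrite -(inj_eq trmx_inj) trmxK trmx0.
by apply: trmx_inj; rewrite trmx_mul trmxK vA linearZ /= trmxK.
Qed.

Lemma horner_eigenvector n (A : 'M[C]_n.+1) (x : 'cV_n.+1) s (d : {poly C}) :
  A *m x = s *: x -> horner_mx A d *m x = d.[s] *: x.
Proof.
move=> Ax; elim/poly_ind: d => [|d c IH]; first by rewrite rmorph0 mul0mx horner0 scale0r.
rewrite rmorphD rmorphM /= horner_mx_C horner_mx_X mulmxDl -mulmxA Ax -scalemxAr IH.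
by rewrite mul_scalar_mx !hornerE scalerA scalerDl mulrC.
Qed.

(** Let [d] be the product of the denominators of the entries of [F]; it does not vanish at [s]. As
    [d F] is polynomial, [K A^k] kills [d(A) B] for every [k]; observability and then
    controllability give [d(A) = 0]. An eigenvector [x] for [s] would satisfy [d(A) x = d(s) x],
    which is nonzero. *)
Lemma minimal_regular_unit m n (A : 'M[C]_n) (B : 'M[C]_(n, m)) K D F s :
  minimal_realization A B K D F -> mx_regular F s -> s%:M - A \in unitmx.
Proof.
move=> minF regF; have obs := minimal_observable minF.
have ctrl := minimal_controllable minF.
case: minF => /realizationP[X EX EF] _.
apply: contraT => /eigenvalue_char_root[x x0 Ax].
case: n => [|n] in A B K X EX EF obs ctrl x x0 Ax *; first by rewrite [x]flatmx0 eqxx in x0.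
pose d := \prod_i \prod_j rat_den (F i j).
have d0 : d.[s] != 0.
  rewrite horner_prod; apply/prodf_neq0 => i _; rewrite horner_prod; apply/prodf_neq0 => j _.
  exact: regF.
have [N EN] : exists N, d%:F *: F = map_mx toF N.
  exists (\matrix_(i, j) (rat_num (F i j) * (d %/ rat_den (F i j)))).
  apply/matrixP => i j; rewrite !mxE.
  have [den0 EFij] := rat_numdenE (F i j).
  have dv : rat_den (F i j) %| d.
    by rewrite /d (bigD1 i) //= (bigD1 j) //= dvdp_mulr // dvdp_mulr.
  transitivity ((d %/ rat_den (F i j) * rat_den (F i j))%:F
      * ((rat_num (F i j))%:F / (rat_den (F i j))%:F)).
    by rewrite divpK //; congr (_ * _).
  by rewrite tofracM mulrCA mulfK ?tofrac_eq0 // [RHS]tofracM.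
have KX : d%:F *: (mx_const K *m X) = map_mx toF (N - d *: map_mx polyC D).
  rewrite map_mxB map_mxZ -EN -map_mx_comp -mx_constE -scalerBr EF.
  by rewrite addrK.
have KAdB := poly_multiple_transfer EX KX.
have dB k : horner_mx A d *m A ^+ k *m B = 0.
  apply: (observable_inj obs) => l; rewrite !mulmxA -[_ *m _ *m A ^+ k]mulmxA.
  rewrite (_ : horner_mx A d *m A ^+ k = A ^+ k *m horner_mx A d); last first.
    have -> : A ^+ k = horner_mx A 'X^k by rewrite rmorphXn /= horner_mx_X.
    exact: comm_horner_mx2.
  rewrite mulmxA -[K *m _ *m _]mulmxA (_ : A ^+ l *m A ^+ k = A ^+ (l + k)).
    by rewrite -[LHS]mulmxA KAdB.
  by rewrite exprD.
have := horner_eigenvector d Ax; rewrite (ctrl _ _ dB) mul0mx => /esym/eqP.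
by rewrite scaler_eq0 (negPf d0) (negPf x0).
Qed.

Lemma realization_similar m n (A L : 'M[C]_n) (B : 'M[C]_(n, m)) K D F :
  L \in unitmx -> minimal_realization A B K D F ->
  minimal_realization (L *m A *m invmx L) (L *m B) (K *m invmx L) D F.
Proof.
move=> L1 [rF min]; split=> //.
apply: (@realization_reduce _ _ _ A); first by rewrite mulmxKV.
by rewrite mulmxKV.
Qed.

End Realizations.

(** * Positive matrices and Gram factorizations *)

Section HermitianMatrices.
Variable C : numClosedFieldType.

Lemma trmxCM m n p (A : 'M[C]_(m, n)) (B : 'M[C]_(n, p)) :
  (A *m B)^t* = B^t* *m A^t*.
Proof. by rewrite trmx_mul map_mxM. Qed.

Lemma trmxCD m n (A B : 'M[C]_(m, n)) : (A + B)^t* = A^t* + B^t*.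
Proof. by rewrite linearD /= map_mxD. Qed.

Lemma trmxCN m n (A : 'M[C]_(m, n)) : (- A)^t* = - A^t*.
Proof. by rewrite linearN /= map_mxN. Qed.

Lemma trmxCB m n (A B : 'M[C]_(m, n)) : (A - B)^t* = A^t* - B^t*.
Proof. by rewrite trmxCD trmxCN. Qed.

Lemma trmxCZ m n a (A : 'M[C]_(m, n)) : (a *: A)^t* = a^* *: A^t*.
Proof. by rewrite linearZ /= map_mxZ. Qed.

Lemma trmxC0 m n : (0 : 'M[C]_(m, n))^t* = 0.
Proof. by rewrite trmx0 map_mx0. Qed.

Lemma trmxC_scalar n (a : C) : (a%:M : 'M_n)^t* = a^*%:M.
Proof. by rewrite tr_scalar_mx map_scalar_mx. Qed.

Lemma trmxC1 n : (1%:M : 'M[C]_n)^t* = 1%:M.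
Proof. by rewrite trmxC_scalar rmorph1. Qed.

Lemma trmxCV n (A : 'M[C]_n) : (invmx A)^t* = invmx (A^t*).
Proof. by rewrite trmx_inv map_invmx. Qed.

Lemma trmxC_unit n (A : 'M[C]_n) : (A^t* \in unitmx) = (A \in unitmx).
Proof. by rewrite map_unitmx unitmx_tr. Qed.

Lemma psd_congr m n (P : 'M[C]_n) (M : 'M[C]_(n, m)) : psd P -> psd (M^t* *m P *m M).
Proof.
move=> [hP pP]; split; first by rewrite !trmxCM trmxCK hP mulmxA.
by move=> x; have := pP (M *m x); rewrite trmxCM !mulmxA.
Qed.

Lemma psd1 n : psd (1%:M : 'M[C]_n).
Proof.
split=> [|x]; first exact: trmxC1.
by rewrite mulmx1 mxE sumr_ge0 // => i _; rewrite !mxE mulrC mul_conjC_ge0.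
Qed.

Lemma psd_gram m n (M : 'M[C]_(n, m)) : psd (M^t* *m M).
Proof. by rewrite -[M in M^t* *m _]mul1mx trmxCM trmxC1; exact/psd_congr/psd1. Qed.

Lemma psdZ n (P : 'M[C]_n) a : 0 <= a -> psd P -> psd (a *: P).
Proof.
move=> a0 [hP pP]; split; first by rewrite trmxCZ hP (CrealP _) ?ger0_real.
by move=> x; rewrite -scalemxAr -scalemxAl mxE mulr_ge0.
Qed.

Lemma gram_eq0 m n (M : 'M[C]_(n, m)) : M^t* *m M = 0 -> M = 0.
Proof.
move=> E; apply/matrixP => i j; have /matrixP/(_ j j) := E.
rewrite !mxE => /eqP; rewrite psumr_eq0 => [/allP/(_ i)|k _].
  by rewrite mem_index_enum !mxE mulrC mul_conjC_eq0 => /(_ isT)/eqP.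
by rewrite !mxE mulrC mul_conjC_ge0.
Qed.

Lemma cogram_eq0 m n (M : 'M[C]_(n, m)) : M *m M^t* = 0 -> M = 0.
Proof. by rewrite -{1}[M]trmxCK => /gram_eq0 M0; rewrite -[M]trmxCK M0 trmxC0. Qed.

(** If [S] is the square root of [P], the hypothesis says that the Gram matrix of [S x] is zero. *)
Lemma psd_ker m n (P : 'M[C]_n) (x : 'M[C]_(n, m)) :
  psd P -> x^t* *m P *m x = 0 -> P *m x = 0.
Proof.
move=> /mxsqrtP[[hS _] SS]; rewrite -{}SS => xPx.
have Sx : mxsqrt P *m x = 0.
  by apply: gram_eq0; rewrite trmxCM hS -mulmxA mulmxA -mulmxA -xPx !mulmxA.
by rewrite -mulmxA Sx mulmx0.
Qed.

Lemma posdef_unit n (P : 'M[C]_n) : posdef P -> P \in unitmx.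
Proof.
move=> [hP pP]; rewrite -row_free_unit -kermx_eq0; set Z := kermx P.
suff Z0 : Z^t* = 0 by rewrite -[Z]trmxCK Z0 trmxC0.
have PZ : P *m Z^t* = 0 by rewrite -{1}hP -trmxCM mulmx_ker trmxC0.
apply/matrixP => i j; rewrite [RHS]mxE; have := pP (col j (Z^t*)).
rewrite -mulmxA {3}colE [P *m (_ *m _)]mulmxA PZ mul0mx mulmx0 mxE ltxx.
by case: eqVneq => [/colP/(_ i)|_ /(_ isT)//]; rewrite !mxE.
Qed.

Lemma posdefE n (P : 'M[C]_n) : posdef P <-> psd P /\ P \in unitmx.
Proof.
split=> [pP|[pP uP]]; first by split; [exact: posdef_psd | exact: posdef_unit].
split=> [|x x0]; first by case: pP.
rewrite lt_def; case: (pP) => _ -> //; rewrite andbT; apply: contra x0 => /eqP xPx.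
rewrite -(mulKmx uP x) (psd_ker pP) ?mulmx0 //.
by apply/matrixP => i j; rewrite !ord1 xPx mxE.
Qed.

Lemma posdef_congr n (P M : 'M[C]_n) :
  M \in unitmx -> posdef P -> posdef (M^t* *m P *m M).
Proof.
move=> uM /posdefE[pP uP]; apply/posdefE; split; first exact: psd_congr.
by rewrite !unitmx_mul trmxC_unit uM uP.
Qed.

Lemma posdefD n (P Q : 'M[C]_n) : posdef P -> psd Q -> posdef (P + Q).
Proof.
move=> [hP pP] [hQ pQ]; split; first by rewrite trmxCD hP hQ.
by move=> x x0; rewrite mulmxDr mulmxDl mxE ltr_wpDr // pP.
Qed.

Lemma posdefZ n (P : 'M[C]_n) a : 0 < a -> posdef P -> posdef (a *: P).
Proof.
move=> a0 [hP pP]; split; first by rewrite trmxCZ hP (CrealP _) ?gtr0_real.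
by move=> x x0; rewrite -scalemxAr -scalemxAl mxE mulr_gt0 ?pP.
Qed.

Lemma posdef1 n : posdef (1%:M : 'M[C]_n).
Proof. by apply/posdefE; split; [exact: psd1 | exact: unitmx1]. Qed.

Lemma posdef_scalar n a : 0 < a -> posdef (a%:M : 'M[C]_n).
Proof. by move=> a0; rewrite -scalemx1; apply: posdefZ => //; exact: posdef1. Qed.

Lemma posdefV n (P : 'M[C]_n) : posdef P -> posdef (invmx P).
Proof.
move=> pP; have uP := posdef_unit pP; have [hP _] := pP.
have -> : invmx P = (invmx P)^t* *m P *m invmx P.
  by rewrite trmxCV hP mulVmx ?mul1mx.
by apply: posdef_congr; rewrite ?unitmx_inv.
Qed.

Lemma mxsqrt_posdef n (P : 'M[C]_n) : posdef P ->
  [/\ posdef (mxsqrt P), mxsqrt P *m mxsqrt P = P, (mxsqrt P)^t* = mxsqrt P &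
      mxsqrt P \in unitmx].
Proof.
move=> pP; have [pS SS] := mxsqrtP (posdef_psd pP).
have uS : mxsqrt P \in unitmx.
  by have := posdef_unit pP; rewrite -{1}SS unitmx_mul => /andP[].
by split=> //; [exact/posdefE | case: pS].
Qed.

Lemma trmxC_row_mx m n1 n2 (A : 'M[C]_(m, n1)) (B : 'M[C]_(m, n2)) :
  (row_mx A B)^t* = col_mx (A^t*) (B^t*).
Proof. by rewrite tr_row_mx map_col_mx. Qed.

Lemma trmxC_col_mx m1 m2 n (A : 'M[C]_(m1, n)) (B : 'M[C]_(m2, n)) :
  (col_mx A B)^t* = row_mx (A^t*) (B^t*).
Proof. by rewrite tr_col_mx map_row_mx. Qed.

Lemma trmxC_block_mx m1 m2 n1 n2 (A : 'M[C]_(m1, n1)) (B : 'M[C]_(m1, n2))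
    (D : 'M[C]_(m2, n1)) (E : 'M[C]_(m2, n2)) :
  (block_mx A B D E)^t* = block_mx (A^t*) (D^t*) (B^t*) (E^t*).
Proof. by rewrite tr_block_mx map_block_mx. Qed.

Lemma psd_block_diag m n (P : 'M[C]_m) (Q : 'M[C]_n) :
  psd P -> psd Q -> psd (block_mx P 0 0 Q).
Proof.
move=> [hP pP] [hQ pQ]; split; first by rewrite trmxC_block_mx hP hQ !trmxC0.
move=> x; rewrite -[x]vsubmxK trmxC_col_mx mul_row_block !mulmx0 addr0 add0r.
by rewrite mul_row_col mxE addr_ge0.
Qed.

Lemma orthonormal_complement r m (X : 'M[C]_(r, m)) : X \is unitarymx ->
  exists2 N : 'M[C]_(m - r, m), N \is unitarymx & X *m N^t* = 0.
Proof.
move=> uX; set Z := kermx (X^t*).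
have rkZ : \rank Z = (m - r)%N.
  by rewrite mxrank_ker mxrank_map mxrank_tr mxrank_unitary.
rewrite -rkZ; exists (schmidt (row_base Z)).
  by apply: schmidt_unitarymx; exact: rank_leq_col.
have /sub_kermxP E : (schmidt (row_base Z) <= Z)%MS.
  by rewrite eqmx_schmidt_free ?eq_row_base // row_base_free.
by rewrite -[X]trmxCK -trmxCM E trmxC0.
Qed.

(** Orthonormal complements extend [X] and [Y] to square unitary matrices; [V] is the adjoint of the
    extension of [Y] times the extension of [X]. *)
Lemma unitary_extension r m (X Y : 'M[C]_(r, m)) :
  X \is unitarymx -> Y \is unitarymx -> exists2 V : 'M[C]_m, V \is unitarymx & X = Y *m V.
Proof.
move=> uX uY; have [Nx uNx XNx] := orthonormal_complement uX.
have [Ny uNy YNy] := orthonormal_complement uY.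
have le_rm : (r <= m)%N by rewrite -(mxrank_unitary uX) rank_leq_col.
have comp (Z : 'M[C]_(r, m)) (N : 'M[C]_(m - r, m)) : Z \is unitarymx -> N \is unitarymx ->
    Z *m N^t* = 0 -> col_mx Z N *m (col_mx Z N)^t* = 1%:M.
  move=> /unitarymxP uZ /unitarymxP uN ZN; rewrite trmxC_col_mx mul_col_row uZ uN ZN.
  by rewrite -[N in N *m Z^t*]trmxCK -trmxCM ZN trmxC0 -scalar_mx_block.
have uWx := comp X Nx uX uNx XNx; have uWy := comp Y Ny uY uNy YNy.
exists ((col_mx Y Ny)^t* *m col_mx X Nx); last first.
  rewrite mulmxA trmxC_col_mx mul_mx_row (unitarymxP uY) YNy mul_row_col mul1mx.
  by rewrite mul0mx addr0.
apply/unitarymxP; rewrite trmxCM trmxCK !mulmxA -[_ *m _ *m (col_mx X Nx)^t*]mulmxA uWx mulmx1.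
rewrite -[_ *m col_mx _ _]mul1mx mulmxA mulmxKtV ?subnKC //.
by apply/unitarymxP.
Qed.

(* E has orthonormal rows spanning the range of G = X X^*, so that X = E^* (E X)
   and Y = E^* (E Y), where E X and E Y have the same invertible Gram matrix. *)
Lemma gram_unitary n m (X Y : 'M[C]_(n, m)) : X *m X^t* = Y *m Y^t* ->
  exists2 V : 'M[C]_m, V \is unitarymx & X = Y *m V.
Proof.
move=> XY; have [G XX] : exists G, X *m X^t* = G by exists (X *m X^t*).
have hG : G^t* = G by rewrite -XX trmxCM trmxCK.
set E := schmidt (row_base G).
have uE : E *m E^t* = 1%:M by apply/unitarymxP/schmidt_unitarymx/rank_leq_col.
have eqE : (E :=: G)%MS.
  exact: eqmx_trans (eqmx_schmidt_free (row_base_free _)) (eq_row_base _).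
have /submxP[c Gc] : (G <= E)%MS by rewrite eqE.
have EEG : E^t* *m E *m G = G.
  have GE : E^t* *m c^t* = G by rewrite -trmxCM -Gc hG.
  transitivity (E^t* *m E *m (E^t* *m c^t*)); first by congr (_ *m _).
  by rewrite mulmxA -[_ *m E *m E^t*]mulmxA uE mulmx1.
have proj (Z : 'M[C]_(n, m)) : Z *m Z^t* = G -> Z = E^t* *m (E *m Z).
  move=> ZZ; apply/eqP; rewrite -subr_eq0; apply/eqP.
  apply: cogram_eq0; rewrite trmxCB mulmxBl mulmxBr ZZ !trmxCM trmxCK mulmxBr !mulmxA ZZ.
  rewrite -![E^t* *m E *m Z *m Z^t*]mulmxA ZZ EEG.
  by rewrite subrr.
have [P PE] : exists P, E *m G *m E^t* = P by exists (E *m G *m E^t*).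
have gramE (Z : 'M[C]_(n, m)) : Z *m Z^t* = G -> E *m Z *m (E *m Z)^t* = P.
  by move=> ZZ; rewrite trmxCM mulmxA -[_ *m Z *m _]mulmxA ZZ.
have pP : posdef P.
  have psdP : psd P by rewrite -(gramE X) // -{1}[E *m X]trmxCK; exact: psd_gram.
  apply/posdefE; split=> //; rewrite -row_free_unit -kermx_eq0; apply/eqP.
  set z := kermx P; have zP : z *m P = 0 by exact: mulmx_ker.
  have zEX : z *m (E *m X) = 0.
    by apply: cogram_eq0; rewrite trmxCM mulmxA -(mulmxA z) gramE // zP mul0mx.
  have /submxP[d Ed] : (E <= G)%MS by rewrite eqE.
  have Ed' : E^t* = X *m X^t* *m d^t* by rewrite {1}Ed trmxCM hG XX.
  by rewrite -[z]mulmx1 -uE Ed' !mulmxA -(mulmxA z E) zEX !mul0mx.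
have [pS SS hS uS] := mxsqrt_posdef pP; set S := mxsqrt P in pS SS hS uS.
(* The inverse square root of the common Gram matrix [P] turns [E X] and [E Y] into matrices with
   orthonormal rows, to which [unitary_extension] applies. *)
have unit_part (Z : 'M[C]_(n, m)) : Z *m Z^t* = G -> invmx S *m (E *m Z) \is unitarymx.
  move=> /gramE ZZ; apply/unitarymxP; rewrite trmxCM trmxCV hS mulmxA -(mulmxA (invmx S)) ZZ.
  by rewrite -SS mulKmx ?mulmxV.
have [V uV EV] := unitary_extension (unit_part X XX) (unit_part Y (etrans (esym XY) XX)).
exists V => //; rewrite (proj X) // (proj Y) -?XY // -mulmxA; congr (_ *m _).
by have := congr1 (mulmx S) EV; rewrite -(mulmxA (invmx S)) !mulKVmx.
Qed.

End HermitianMatrices.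

(** * Hurwitz matrices and Lyapunov equations *)

Section Lyapunov.
Variable C : numClosedFieldType.

Definition hurwitz n (A : 'M[C]_n) : Prop :=
  forall s, 0 <= 'Re s -> s%:M - A \in unitmx.

Lemma horner_mx_unit n (A : 'M[C]_n.+1) p :
  coprimep p (char_poly A) -> horner_mx A p \in unitmx.
Proof.
move=> /Bezout_eq1_coprimepP[u /(congr1 (horner_mx A))].
rewrite rmorphD !rmorphM /= Cayley_Hamilton mulr0 addr0 rmorph1.
by move=> /mulmx1_unit[].
Qed.

(** The eigenvalues of [- A^*] are the [- z^*] with [z] an eigenvalue of [A]; they lie in the open
    right half plane, where [A] has none. *)
Lemma hurwitz_coprime n (A : 'M[C]_n) :
  hurwitz A -> coprimep (char_poly (- A^t*)) (char_poly A).
Proof.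
move=> hA; apply: Pdiv.ClosedField.root_coprimep => s.
rewrite root_char_poly => As; rewrite -[_ != 0]/(~~ root _ _) root_char_poly negbK.
have [/hA//|] := real_leP (real0 _) (Creal_Re s) => Re_s.
have : (- s^*)%:M - A \in unitmx by apply: hA; rewrite raddfN /= Re_conj oppr_ge0 ltW.
rewrite -trmxC_unit trmxCB trmxC_scalar rmorphN /= conjCK raddfN /= -opprD.
by rewrite -scaleN1r unitmxZ ?unitrN1 // => U; rewrite opprK U in As.
Qed.

Lemma horner_mxE n (A : 'M[C]_n.+1) p : horner_mx A p = \sum_(i < size p) p`_i *: A ^+ i.
Proof.
rewrite -[p in LHS]coefK poly_def rmorph_sum /=; apply: eq_bigr => i _.
by rewrite linearZ /= rmorphXn /= horner_mx_X.
Qed.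

Lemma horner_mx_intertwine n1 n2 (A1 : 'M[C]_n1.+1) (A2 : 'M[C]_n2.+1) M p :
  A1 *m M = M *m A2 -> horner_mx A1 p *m M = M *m horner_mx A2 p.
Proof.
move=> AM; elim/poly_ind: p => [|p c IH].
  by rewrite (raddf0 (horner_mx A1)) (raddf0 (horner_mx A2)) mul0mx mulmx0.
rewrite (rmorphD (horner_mx A1)) (rmorphD (horner_mx A2)).
rewrite (rmorphM (horner_mx A1)) (rmorphM (horner_mx A2)) /=.
rewrite !horner_mx_C !horner_mx_X mulmxDl mulmxDr scalar_mxC; congr (_ + _).
by rewrite -mulmxA AM mulmxA IH mulmxA.
Qed.

(** The equation says that [P] intertwines [- A^*] and [A]. If [p] is the characteristic polynomial
    of [- A^*], Cayley-Hamilton gives [P p(A) = 0], and [p(A)] is invertible by coprimality. *)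
Lemma lyapunov_inj n (A P : 'M[C]_n) : hurwitz A -> A^t* *m P + P *m A = 0 -> P = 0.
Proof.
case: n => [|n] in A P * => hA; first by rewrite [P]flatmx0.
move=> /eqP; rewrite addr_eq0 => /eqP E.
have E' : - A^t* *m P = P *m A by rewrite mulNmx E opprK.
have := horner_mx_intertwine (char_poly (- A^t*)) E'; rewrite Cayley_Hamilton mul0mx.
move=> /esym/(congr1 (mulmx^~ (invmx (horner_mx A (char_poly (- A^t*)))))).
by rewrite mulmxK ?mul0mx // horner_mx_unit // hurwitz_coprime.
Qed.

(** The Lyapunov operator is injective on a finite-dimensional space, hence onto. The adjoint of [P]
    solves the same equation, so uniqueness makes [P] Hermitian. *)
Lemma lyapunov_solution n (A Q : 'M[C]_n) : hurwitz A -> Q^t* = Q ->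
  exists2 P : 'M[C]_n, P^t* = P & A^t* *m P + P *m A = Q.
Proof.
move=> hA hQ; pose f := mulmx (A^t*) \+ mulmxr A.
have uL : lin_mx f \in unitmx.
  rewrite -row_free_unit -kermx_eq0; apply/eqP/row_matrixP => i.
  rewrite row0; set u := row i _.
  have : u *m lin_mx f = 0 by apply/sub_kermxP; exact: row_sub.
  rewrite mul_rV_lin => /eqP; rewrite mxvec_eq0 => /eqP /(lyapunov_inj hA) u0.
  by rewrite -[u]vec_mxK u0 linear0.
have [P EP] : exists P, A^t* *m P + P *m A = Q.
  exists (vec_mx (mxvec Q *m invmx (lin_mx f))).
  have := mx_rV_lin f (mxvec Q *m invmx (lin_mx f)).
  by rewrite mulmxKV // mxvecK => /esym.
exists P => //; apply/eqP; rewrite -subr_eq0; apply/eqP/(lyapunov_inj hA).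
have := congr1 (fun M => M^t*) EP; rewrite trmxCD !trmxCM trmxCK hQ -EP => E.
by rewrite mulmxBr mulmxBl addrACA -opprD [_ + P^t* *m A]addrC E subrr.
Qed.

(* If the corner entry p0 of P vanishes, then so does its row v, since
   - x^* is not an eigenvalue of A1; otherwise the Schur complement P' of p0
   satisfies the Lyapunov inequality for A1, as G P = P' J and G A J^* = A1. *)
Lemma psd_lyapunov_trig n (A : 'M[C]_n) : is_trig_mx A ->
  forall P : 'M[C]_n, (forall i, 'Re (A i i) < 0) -> P^t* = P ->
  psd (- (A *m P + P *m A^t*)) -> psd P.
Proof.
move: n A; apply: trigsqmx_ind => [|n x c A1 trA IH] P ReA hP pQ.
  by split=> // x; rewrite [x]flatmx0 mulmx0 mxE.
have [p0 [v [P1 [EP hP1 Rp0]]]] : exists p0 (v : 'rV[C]_n) (P1 : 'M[C]_n),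
    [/\ P = block_mx p0%:M v (v^t*) P1, P1^t* = P1 & p0 \is Num.real].
  exists (P 0 0), (@ursubmx _ 1 n 1 n P), (@drsubmx _ 1 n 1 n P).
  have := hP; rewrite -{1}(@submxK _ 1 n 1 n P) trmxC_block_mx => E.
  have := E; rewrite -{5}(@submxK _ 1 n 1 n P) => /eq_block_mx[Eul _ Edl Edr].
  split=> //; last by apply/CrealP; rewrite -{2}hP !mxE.
  rewrite -{1}(@submxK _ 1 n 1 n P) Edl; congr (block_mx _ _ _ _).
  by apply/matrixP => i j; rewrite !ord1 !mxE eqxx mulr1n; congr (P _ _); exact/val_inj.
have Rex : x 0 0 + (x 0 0)^* < 0.
  by have := ReA (lshift n 0); rewrite block_mxEul ReE pmulr_llt0 ?invr_gt0 ?ltr0n.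
have ReA1 i : 'Re (A1 i i) < 0 by have := ReA (rshift 1 i); rewrite block_mxEdr.
move: hP; rewrite EP in pQ * => hP.
set Q := - _ in pQ.
have EQ : Q = block_mx (- ((x 0 0 + (x 0 0)^*) * p0)%:M)
    (- (x *m v + p0 *: c^t* + v *m A1^t*))
    (- (p0 *: c + A1 *m v^t* + v^t* *m x^t*))
    (- (c *m v + A1 *m P1 + (v^t* *m c^t* + P1 *m A1^t*))).
  rewrite /Q trmxC_block_mx trmxC0 !mulmx_block !mul0mx !mulmx0 !addr0.
  rewrite add_block_mx opp_block_mx.
  rewrite !mul_mx_scalar !mul_scalar_mx.
  congr (block_mx _ _ _ _); congr (- _); rewrite ?addrA //.
  by apply/matrixP => i j; rewrite !ord1 !mxE eqxx mulr1n mulrDl; congr (_ + _); exact: mulrC.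
have p0_ge0 : 0 <= p0.
  have := pQ.2 (col_mx 1%:M 0); rewrite EQ trmxC_col_mx trmxC0 trmxC1 mul_row_block.
  rewrite !mul1mx !mul0mx !addr0 mul_row_col mulmx1 mulmx0 addr0 !mxE eqxx mulr1n oppr_ge0.
  by rewrite nmulr_rle0.
pose J : 'M[C]_(n, 1 + n) := row_mx 0 1%:M.
have JG (Y : 'M[C]_(n, 1)) : J *m (row_mx Y 1%:M)^t* = 1%:M.
  by rewrite trmxC_row_mx mul_row_col mul0mx add0r trmxC1 mulmx1.
have [p00|p0_neq0] := eqVneq p0 0.
  (* The corner of [Q] is a multiple of [p0], and a positive semidefinite matrix with a zero
     diagonal entry has a zero column there. The lower part of this column is the eigenvector
     equation for [v^*]. *)
  have Qe : Q *m col_mx (1%:M : 'M_1) 0 = 0.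
    apply: (psd_ker pQ); rewrite EQ trmxC_col_mx trmxC0 trmxC1 mul_row_block.
    rewrite !mul1mx !mul0mx !addr0 mul_row_col mulmx1 mulmx0 addr0 p00 mulr0.
    by rewrite (raddf0 (@scalar_mx C 1)) oppr0.
  have v0 : v = 0.
    have uA : (- (x 0 0)^*)%:M - A1 \in unitmx.
      rewrite unitmxE det_trig ?unitfE; last first.
        apply/is_trig_mxP => i j ij; rewrite !mxE (is_trig_mxP trA) // subr0.
        by rewrite -val_eqE ltn_eqF.
      apply/prodf_neq0 => i _; rewrite !mxE eqxx mulr1n subr_eq0.
      apply: contraTneq (ReA1 i) => <-; rewrite raddfN /= Re_conj oppr_lt0.
      by rewrite le_gtF // ReE pmulr_lle0 ?invr_gt0 ?ltr0n // ltW.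
    move: Qe; rewrite EQ p00 mul_block_col !mulmx1 !mulmx0 !addr0 !scale0r add0r.
    rewrite -[RHS]vsubmxK => /eq_col_mx[_].
    move/eqP; rewrite linear0 oppr_eq0 => /eqP E.
    suff v0 : v^t* = 0 by rewrite -[v]trmxCK v0 trmxC0.
    rewrite -[LHS](mulKmx uA) mulmxBl mul_scalar_mx; apply/eqP.
    have -> : - (x 0 0)^* *: v^t* - A1 *m v^t* = 0; last by rewrite mulmx0.
    apply/eqP; rewrite -oppr_eq0 -E; apply/eqP.
    rewrite opprB scaleNr opprK; congr (_ + _).
    by rewrite [x^t*]mx11_scalar mul_mx_scalar !mxE.
  rewrite p00 v0 trmxC0 (raddf0 (@scalar_mx C 1)); apply: psd_block_diag.
    by split=> [|y]; rewrite ?trmxC0 // mulmx0 mul0mx mxE.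
  apply: IH => //; have := psd_congr (J^t*) pQ; rewrite trmxCK /J EQ v0.
  rewrite trmxC_row_mx trmxC0 trmxC1 mul_row_block !mul0mx !add0r !mul1mx mul_row_col.
  by rewrite trmxC0 !mulmx0 mulmx1 !add0r.
have p0_gt0 : 0 < p0 by rewrite lt_def p0_neq0.
pose G : 'M[C]_(n, 1 + n) := row_mx (- (p0^-1 *: v^t*)) 1%:M.
pose P' := P1 - p0^-1 *: (v^t* *m v).
have GP : G *m block_mx p0%:M v (v^t*) P1 = P' *m J.
  rewrite mul_row_block mul_mx_row !mul1mx mulmx0 mulmx1 mulNmx mul_mx_scalar.
  rewrite scalerA divff // scale1r addNr; congr row_mx.
  by rewrite addrC mulNmx -scalemxAl.
have hP' : P'^t* = P'.
  rewrite trmxCB hP1 trmxCZ trmxCM trmxCK; congr (_ - _ *: _).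
  by apply/CrealP; rewrite rpredV.
have psdP' : psd P'.
  apply: IH => //; have := psd_congr (G^t*) pQ; rewrite trmxCK /Q.
  rewrite mulmxN mulNmx mulmxDr mulmxDl; 
  set PB := block_mx p0%:M v _ _ in GP hP *; set AB := block_mx x _ _ _.
  have E : G *m (PB *m AB^t*) *m G^t* = P' *m A1^t*.
    rewrite mulmxA GP -!mulmxA; congr (_ *m _).
    rewrite -[J]trmxCK -!trmxCM; congr (_^t*).
    rewrite trmxC_row_mx trmxC0 trmxC1 mul_row_block !mul1mx mul_row_col.
    by rewrite !mulmx0 !add0r mulmx1.
  congr (psd (- (_ + _))).
    apply: (can_inj (@trmxCK _ _ _)).
    by rewrite !trmxCM hP' trmxCK -E hP !mulmxA.
  exact: E.
(* Block elimination: [P] is congruent to the diagonal of [p0] and its Schur complement. *)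
pose S : 'M[C]_(1 + n) := block_mx 1%:M (p0^-1 *: v) 0 1%:M.
have -> : block_mx p0%:M v (v^t*) P1 = S^t* *m block_mx p0%:M 0 0 P' *m S.
  rewrite trmxC_block_mx !trmxC1 trmxC0 !mulmx_block.
  rewrite !mulmx0 !mul0mx !mul1mx !addr0 !add0r !mulmx1 mul_scalar_mx mul_mx_scalar.
  have hp0 : p0^-1^* = p0^-1 by apply/CrealP; rewrite rpredV.
  rewrite trmxCZ hp0 !scalerA divff // !scale1r -scalemxAr.
  by rewrite [_ + P']addrC subrK addr0.
apply: psd_congr; apply: psd_block_diag => //.
by rewrite -scalemx1; apply: psdZ => //; exact: psd1.
Qed.

(** A unitary change of basis makes [A^*] triangular, and this triangular matrix takes the place of
    [A] in [psd_lyapunov_trig]. Its diagonal entries are conjugates of eigenvalues of [A], hence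
    have negative real part. *)
Lemma psd_lyapunov n (A P : 'M[C]_n) : hurwitz A -> P^t* = P ->
  psd (- (A^t* *m P + P *m A)) -> psd P.
Proof.
case: n => [|n] in A P *; first by move=> *; split=> // x; rewrite [x]flatmx0 mulmx0 mxE.
move=> hA hP pQ; have [U uU trU] := Schur (A^t*) (ltn0Sn n).
have trT : is_trig_mx (U *m A^t* *m U^t*) by rewrite -conjymx.
set T := U *m _ *m _ in trT.
have UU : U^t* *m U = 1%:M by rewrite -[U^t*]mul1mx mulmxKtV.
have -> : P = U^t* *m (U *m P *m U^t*) *m U.
  by rewrite !mulmxA UU mul1mx -mulmxA UU mulmx1.
apply: psd_congr; apply: (psd_lyapunov_trig trT); last first.
- have := psd_congr (U^t*) pQ; rewrite trmxCK /T mulmxN mulNmx mulmxDr mulmxDl.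
  rewrite !trmxCM !trmxCK !mulmxA -[_ *m U^t* *m U]mulmxA.
  by rewrite UU mulmx1 -[_ *m U^t* *m U]mulmxA UU mulmx1.
- by rewrite !trmxCM trmxCK hP mulmxA.
move=> i; have [|//] := real_leP (real0 _) (Creal_Re (T i i)).
rewrite -Re_conj => /hA; rewrite -trmxC_unit trmxCB trmxC_scalar conjCK => uA.
have : (T i i)%:M - T \in unitmx.
  have -> : (T i i)%:M - T = U *m ((T i i)%:M - A^t*) *m U^t*.
    rewrite mulmxBr mulmxBl scalar_mxC -[_%:M *m U *m _]mulmxA.
    by rewrite (unitarymxP uU) mulmx1.
  by rewrite !unitmx_mul uA trmxC_unit unitarymx_unit.
clearbody T; rewrite unitmxE det_trig ?unitfE; last first.
  apply/is_trig_mxP => j k jk; rewrite !mxE (is_trig_mxP trT j k jk) subr0.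
  by rewrite -val_eqE ltn_eqF.
by move/prodf_neq0/(_ i isT); rewrite !mxE eqxx subrr eqxx.
Qed.

(** The solution is positive semidefinite. Its kernel is killed by [K] and stable under [A], so
    observability makes the kernel zero. *)
Lemma lyapunov_posdef m n (A : 'M[C]_n) (K : 'M[C]_(m, n)) (T : 'M[C]_m) :
  hurwitz A -> observable A K -> posdef T ->
  exists2 P, posdef P & A^t* *m P + P *m A = - (K^t* *m T *m K).
Proof.
move=> hA obs /posdefE[pT uT].
have pQ := psd_congr K pT; have [hQ _] := pQ.
have [|P hP EP] := lyapunov_solution (Q := - (K^t* *m T *m K)) hA; first by rewrite trmxCN hQ.
exists P => //; have pP : psd P by apply: (psd_lyapunov hA) => //; rewrite EP opprK.
apply/posdefE; split=> //; rewrite -row_free_unit -kermx_eq0; set Z := kermx P.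
suff Z0 : Z^t* = 0 by rewrite -[Z]trmxCK Z0 trmxC0.
have PZ : P *m Z^t* = 0 by rewrite -{1}hP -trmxCM mulmx_ker trmxC0.
have invariant p (x : 'M_(n, p)) : P *m x = 0 -> K *m x = 0 /\ P *m (A *m x) = 0.
  move=> Px.
  have Kx : K *m x = 0.
    have E : T *m (K *m x) = 0.
      apply: (psd_ker pT); rewrite trmxCM -!mulmxA [T *m _]mulmxA [K^t* *m _]mulmxA.
      rewrite [K^t* *m (T *m K)]mulmxA -[K^t* *m T *m K]opprK -EP mulNmx mulmxDl.
      rewrite -!mulmxA Px mulmx0 add0r mulmxN [x^t* *m _]mulmxA.
      by rewrite -{1}hP -trmxCM Px trmxC0 mul0mx oppr0.
    by rewrite -[K *m x](mulKmx uT) E mulmx0.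
  split=> //; have := congr1 (mulmx^~ x) EP; rewrite mulmxDl -!mulmxA Px mulmx0 add0r => ->.
  by rewrite mulNmx -!mulmxA Kx !mulmx0 oppr0.
apply: (observable_inj obs) => k.
suff : P *m (A ^+ k *m Z^t*) = 0 by move/invariant => []; rewrite mulmxA.
elim: k => [|k IHk]; first by rewrite expr0 mul1mx.
by rewrite exprS -mulmxA; case: (invariant _ _ IHk).
Qed.

End Lyapunov.

(** * Canonical functions in state space *)

Section Canonical.
Variable C : numClosedFieldType.

(** The Lyapunov equation eliminates [X^* K^* T K X], then [A X = s X - B] eliminates [A]; what
    stays quadratic in [X] carries the factor [s + s^*]. *)
Lemma HP_defect_state_space m n (A P : 'M[C]_n) (B X : 'M[C]_(n, m)) (K : 'M[C]_(m, n))
    (D T : 'M[C]_m) s :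
  P^t* = P -> T^t* = T -> A^t* *m P + P *m A = - (K^t* *m T *m K) ->
  (s%:M - A) *m X = B ->
  let Fs := K *m X + D in
  let M := K - D^t* *m T *m K - B^t* *m P in
  Fs + Fs^t* - (T + Fs^t* *m T *m Fs) =
    (D + D^t* - (T + D^t* *m T *m D)) + (M *m X + X^t* *m M^t*)
    + (s + s^*) *: (X^t* *m P *m X).
Proof.
move=> hP hT EP EX /=.
have AX : A *m X = s *: X - B by rewrite -EX mulmxBl mul_scalar_mx opprB addrC subrK.
have XKTKX : X^t* *m K^t* *m T *m K *m X =
    B^t* *m P *m X + X^t* *m P *m B - (s + s^*) *: (X^t* *m P *m X).
  have -> : X^t* *m K^t* *m T *m K *m X = - (X^t* *m (A^t* *m P + P *m A) *m X).
    by rewrite EP mulmxN mulNmx opprK !mulmxA.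
  rewrite mulmxDr mulmxDl !mulmxA -trmxCM AX -[_ *m A *m X]mulmxA AX.
  rewrite trmxCB trmxCZ mulmxBr !mulmxBl -!scalemxAl -!scalemxAr scalerDl.
  by rewrite opprD !opprB [in RHS]opprD addrACA [- _ - _]addrC.
rewrite !trmxCD !trmxCN !trmxCM !trmxCK hP hT.
rewrite !(mulmxDl, mulmxDr, mulmxN, mulNmx, mulmxA) XKTKX.
by apply/matrixP => i j; rewrite !mxE; ring.
Qed.

(** For an eigenvector [x] with [Re s >= 0], the equation equates [2 Re s x^* P x >= 0] with minus
    the [T]-norm of [K x]. Hence [K x = 0], and an eigenvector killed by [K] contradicts
    observability. *)
Lemma lyapunov_hurwitz m n (A P : 'M[C]_n) (K : 'M[C]_(m, n)) (T : 'M[C]_m) :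
  posdef P -> posdef T -> observable A K ->
  A^t* *m P + P *m A = - (K^t* *m T *m K) -> hurwitz A.
Proof.
move=> [_ pP] /posdefE[pT uT] obs EP s s0; apply: contraT => /eigenvalue_char_root[x x0 Ax].
have E : (s + s^*) *: (x^t* *m P *m x) = - ((K *m x)^t* *m T *m (K *m x)).
  have := congr1 (fun Z => x^t* *m Z *m x) EP.
  rewrite mulmxDr mulmxDl mulmxA -trmxCM Ax -!mulmxA Ax trmxCZ.
  rewrite -!scalemxAr -scalemxAl -scalerDl addrC => ->.
  by rewrite trmxCM mulNmx mulmxN !mulmxA.
have xPx := pP x x0.
have ss : 0 <= s + s^* by move: s0; rewrite ReE pmulr_lge0 ?invr_gt0 ?ltr0n.
have TKx : T *m (K *m x) = 0.
  apply: (psd_ker pT); apply/eqP; rewrite -oppr_eq0 -E; apply/eqP/matrixP => i j.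
  rewrite !ord1 [RHS]mxE; apply/eqP; rewrite eq_le; apply/andP; split.
    by rewrite E mxE oppr_le0; case: pT.
  by rewrite mxE mulr_ge0 // ltW.
have Kx : K *m x = 0 by rewrite -[LHS](mulKmx uT) TKx mulmx0.
have : x = 0.
  apply: (observable_inj obs) => k; rewrite -mulmxA.
  have -> : A ^+ k *m x = s ^+ k *: x.
    elim: k => [|k IHk]; first by rewrite !expr0 mul1mx scale1r.
    by rewrite exprS -mulmxA IHk -scalemxAr Ax scalerA -exprSr.
  by rewrite -scalemxAr Kx scaler0.
by move=> xE; rewrite xE eqxx in x0.
Qed.

(** [P] is left general because it will be the identity, a multiple of the identity, and a multiple
    of an observability Gramian. *)
Lemma canonical_of_lyapunov m n (A P : 'M[C]_n) (B : 'M[C]_(n, m)) (K : 'M[C]_(m, n))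
    (D T : 'M[C]_m) F :
  posdef P -> posdef T -> realization A B K D F -> observable A K ->
  A^t* *m P + P *m A = - (K^t* *m T *m K) -> P *m B = K^t* *m (1%:M - T *m D) ->
  D + D^t* = T + D^t* *m T *m D -> canonical_HP T F.
Proof.
move=> pP pT rF obs EP EB ED.
have hA := lyapunov_hurwitz pP pT obs EP.
have [hP _] := pP; have [hT _] := pT.
have defect s : 0 <= 'Re s -> mx_regular F s /\
    exists X : 'M[C]_(n, m), HP_defect T F s = (s + s^*) *: (X^t* *m P *m X).
  move=> s0; have uA := hA s s0; have [regF evF] := realization_eval rF uA.
  split=> //; set X := invmx (s%:M - A) *m B; exists X.
  have EX : (s%:M - A) *m X = B by rewrite mulKVmx.
  rewrite /HP_defect evF -mulmxA -/X /= (HP_defect_state_space D hP hT EP EX) ED subrr add0r.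
  have -> : K - D^t* *m T *m K - B^t* *m P = 0.
    rewrite -{1}hP -trmxCM EB trmxCM trmxCB trmxC1 trmxCM hT trmxCK mulmxBl mul1mx.
    by rewrite subrr.
  by rewrite mul0mx trmxC0 mulmx0 !add0r.
split=> s Re_s.
  have [regF [X ->]] := defect s (ltW Re_s); split=> //.
  apply: psdZ; last exact/psd_congr/posdef_psd.
  by move: Re_s; rewrite ReE pmulr_lgt0 ?invr_gt0 ?ltr0n // => /ltW.
have [|regF [X ->]] := defect s; first by rewrite Re_s.
split=> //; move/eqP: Re_s; rewrite ReE mulf_eq0 invr_eq0 pnatr_eq0 orbF => /eqP ->.
by rewrite scale0r.
Qed.

Lemma block_diag_exp n1 n2 (A : 'M[C]_n1) (E : 'M[C]_n2) k :
  (block_mx A 0 0 E) ^+ k = block_mx (A ^+ k) 0 0 (E ^+ k).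
Proof.
elim: k => [|k IHk]; first by rewrite !expr0 -scalar_mx_block.
by rewrite !exprS IHk [LHS]mulmx_block !(mulmx0, mul0mx, addr0, add0r).
Qed.

Lemma minimal_hurwitz m n (A : 'M[C]_n) (B : 'M[C]_(n, m)) K D T F :
  canonical_HP T F -> minimal_realization A B K D F -> hurwitz A.
Proof.
move=> [hpF canF] minF s; rewrite le_eqVlt => /predU1P[s0|s0].
  by apply: (minimal_regular_unit minF); case: (canF s).
by apply: (minimal_regular_unit minF); case: (hpF s).
Qed.

Lemma canonical_lyapunov m n (A : 'M[C]_n) (B : 'M[C]_(n, m)) (K : 'M[C]_(m, n))
    (D T : 'M[C]_m) F :
  posdef T -> canonical_HP T F -> minimal_realization A B K D F ->
  exists2 P, posdef P &
  [/\ A^t* *m P + P *m A = - (K^t* *m T *m K), P *m B = K^t* *m (1%:M - T *m D) &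
      D + D^t* = T + D^t* *m T *m D].
Proof.
move=> pT canF minF; have hA := minimal_hurwitz canF minF.
have obs := minimal_observable minF; have ctrl := minimal_controllable minF.
have [P pP EP] := lyapunov_posdef hA obs pT; exists P => //.
have [hP _] := pP; have [hT _] := pT.
set M := K - D^t* *m T *m K - B^t* *m P.
(* Infinitely many points of the imaginary axis, where conjugation is negation. *)
pose f k : C := 'i * k%:R.
have f_inj : injective f by move=> k l /(mulfI (neq0Ci C))/eqP; rewrite eqr_nat => /eqP.
have fc k : (f k)^* = - f k by rewrite rmorphM /= conjCi rmorph_nat mulNr.
have Re_f k : 'Re (f k) = 0 by rewrite ReE fc subrr mul0r.
have uA k : (f k)%:M - A \in unitmx by apply: hA; rewrite Re_f.
have uA' k : (f k)%:M + A^t* \in unitmx.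
  have := uA k; rewrite -trmxC_unit trmxCB trmxC_scalar fc raddfN /= -opprD.
  by rewrite -scaleN1r unitmxZ ?unitrN1.
(* This block system has Markov parameters [M A^k B - B^* (- A^* )^k M^*], and on the axis its
   transfer function is the part of the defect linear in [X]. [eval_markov] makes the constant part
   of the defect vanish along with them. *)
pose A' := block_mx A 0 0 (- A^t*); pose B' := col_mx B (M^t*).
pose K' := row_mx M (- B^t*).
have EA' k : (f k)%:M - A' = block_mx ((f k)%:M - A) 0 0 ((f k)%:M + A^t*).
  by rewrite scalar_mx_block opp_block_mx add_block_mx !oppr0 !addr0 opprK.
have uA'' k : (f k)%:M - A' \in unitmx by rewrite EA' block_diag_mx_unit uA uA'.
have [k|/eqP Delta0 KB] := eval_markov (N := - (D + D^t* - (T + D^t* *m T *m D)))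
    (B := B') (K := K') f_inj uA''.
  set X := invmx ((f k)%:M - A) *m B.
  have EX : ((f k)%:M - A) *m X = B by rewrite mulKVmx.
  have [regF evF] := realization_eval minF.1 (uA k).
  have [_] := canF.2 _ (Re_f k).
  rewrite /HP_defect evF -mulmxA -/X /= (HP_defect_state_space D hP hT EP EX).
  rewrite fc subrr scale0r addr0 => /eqP; rewrite addrC addr_eq0 => /eqP <-.
  rewrite EA' invmx_block_diag ?block_diag_mx_unit ?uA ?uA' //.
  rewrite mul_row_block !mulmx0 addr0 add0r mul_row_col -[M *m _ *m _]mulmxA -/X.
  rewrite -/M; congr (_ + _).
  have <- : X^t* *m ((f k)%:M + A^t*) = - B^t*.
    rewrite -[in RHS]EX [in RHS]trmxCM trmxCB trmxC_scalar fc (raddfN (@scalar_mx C n)) /=.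
    by rewrite -opprD mulmxN opprK.
  by rewrite mulmxK.
have KB' k : M *m A ^+ k *m B = B^t* *m (- A^t*) ^+ k *m M^t*.
  have := KB k; rewrite block_diag_exp mul_row_block !mulmx0 addr0 add0r mul_row_col.
  by move/eqP; rewrite !mulNmx subr_eq0 => /eqP.
have M0 : M = 0.
  case: n => [|n] in A B K minF hA obs ctrl P pP EP hP M A' B' K' uA uA' EA' uA'' KB KB' *.
    exact: thinmx0.
  have KBp p : M *m horner_mx A p *m B = B^t* *m horner_mx (- A^t*) p *m M^t*.
    rewrite !horner_mxE !mulmx_sumr !mulmx_suml; apply: eq_bigr => i _.
    by rewrite -!scalemxAr -!scalemxAl KB'.
  (* The extra factor [X^k] yields all the products that controllability asks for. *)
  have MpA : M *m horner_mx A (char_poly (- A^t*)) = 0.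
    apply: ctrl => k; have := KBp (char_poly (- A^t*) * 'X^k).
    rewrite !rmorphM !rmorphXn /= !horner_mx_X Cayley_Hamilton mul0r mulmx0 mul0mx.
    by rewrite !mulmxA.
  have := congr1 (mulmx^~ (invmx (horner_mx A (char_poly (- A^t*))))) MpA.
  by rewrite mulmxK ?mul0mx // horner_mx_unit // hurwitz_coprime.
split=> //; last by move: Delta0; rewrite oppr_eq0 subr_eq0 => /eqP.
move/eqP: M0; rewrite subr_eq0 => /eqP /(congr1 (fun Z => Z^t*)).
by rewrite trmxCB !trmxCM !trmxCK hP hT mulmxBr mulmx1 mulmxA => <-.
Qed.

(** * Boundedness on the half plane and properness *)

Lemma psd_diag n (Q : 'M[C]_n) j : psd Q -> 0 <= Q j j.
Proof.
case=> _ /(_ (delta_mx j 0)).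
rewrite (_ : (delta_mx j 0)^t* = delta_mx 0 j) -?rowE -?colE ?mxE //.
by apply/matrixP => a b; rewrite !mxE andbC; case: andb; rewrite ?rmorph1 ?rmorph0.
Qed.

Lemma horner_norm_le (p : {poly C}) d x : 1 <= x -> (size p <= d.+1)%N ->
  `|p.[x]| <= (\sum_(i < size p) `|p`_i|) * x ^+ d.
Proof.
move=> x1 szp; have x0 : 0 <= x by rewrite (le_trans ler01).
rewrite horner_coef (le_trans (ler_norm_sum _ _ _)) // mulr_suml ler_sum // => i _.
rewrite normrM normrX (ger0_norm x0) ler_wpM2l // ler_weXn2l //.
by rewrite -ltnS (leq_trans (ltn_ord i)).
Qed.

Lemma size_le_of_bounded (p q : {poly C}) M : 0 <= M ->
  (forall x, 1 <= x -> `|p.[x]| <= M * `|q.[x]|) -> (size p <= size q)%N.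
Proof.
move=> M0 le_pq; rewrite leqNgt; apply/negP => lt_qp.
have p0 : p != 0 by rewrite -size_poly_gt0 (leq_ltn_trans _ lt_qp).
have lc0 : 0 < `|lead_coef p| by rewrite normr_gt0 lead_coef_eq0.
have [N szp] : exists N, size p = N.+1.
  by exists (size p).-1; rewrite prednK // size_poly_gt0.
case: N szp => [|N] szp.
  have q0 : q = 0 by apply/eqP; rewrite -size_poly_leq0 -ltnS -szp.
  have [c Ec] : exists c, p = c%:P.
    by exists p`_0; apply: size1_polyC; rewrite szp.
  move: (le_pq 1 (lexx _)); rewrite q0 horner0 normr0 mulr0 normr_le0 Ec hornerC => /eqP c0.
  by rewrite Ec c0 eqxx in p0.
pose p' := p - (lead_coef p) *: 'X^(N.+1).
have szp' : (size p' <= N.+1)%N.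
  apply/leq_sizeP => j jN; rewrite coefB coefZ coefXn.
  have [->|jN'] := eqVneq j N.+1; first by rewrite mulr1 lead_coefE szp subrr.
  by rewrite mulr0 subr0 nth_default // szp ltn_neqAle eq_sym jN'.
pose S r := \sum_(i < size (r : {poly C})) `|r`_i|.
have S0 r : 0 <= S r by apply: sumr_ge0.
(* At this point the leading term of [p] beats all the other contributions: [|lead_coef p| x]
   exceeds [S p' + M * S q] by [|lead_coef p|], against [lcx] divided by [x ^+ N]. *)
pose x := 1 + (S p' + M * S q) / `|lead_coef p|.
have x1 : 1 <= x by rewrite lerDl divr_ge0 // addr_ge0 ?mulr_ge0.
have x0 : 0 < x by rewrite (lt_le_trans ltr01).
have lcx : `|lead_coef p| * x ^+ N.+1 <= (S p' + M * S q) * x ^+ N.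
  have -> : `|lead_coef p| * x ^+ N.+1 = `|p.[x] - p'.[x]|.
    rewrite /p' hornerD hornerN hornerZ hornerXn opprB addrC subrK.
    by rewrite normrM normrX (gtr0_norm x0).
  rewrite (le_trans (ler_normB _ _)) // addrC mulrDl lerD //.
    exact: horner_norm_le.
  rewrite (le_trans (le_pq x x1)) // -mulrA ler_wpM2l // horner_norm_le //.
  by rewrite -ltnS -szp.
move: lcx; rewrite exprS mulrA ler_pM2r ?exprn_gt0 // /x mulrDr mulr1.
rewrite mulrCA divff ?gt_eqF // mulr1 -lerBrDr subrr => /(lt_le_trans lc0).
by rewrite ltxx.
Qed.

(* With R the square root of T, completing the square in the HP inequality gives
   (R F - R^-1)^* (R F - R^-1) <= T^-1 - T, so F is bounded on C_R. *)
Lemma canonical_proper m (T : 'M[C]_m) (F : rat_mx C m) :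
  posdef T -> HP T F ->
  forall i j, (size (rat_num (F i j)) <= size (rat_den (F i j)))%N.
Proof.
move=> pT hpF i j; have [pR RR hR uR] := mxsqrt_posdef pT.
move: (mxsqrt T) pR RR hR uR => R pR RR hR uR; set R' := invmx R.
pose c := (invmx T - T) j j.
pose M := \sum_k `|R' i k| * (c + 1 + `|R' k j|).
have HR' : R'^t* = R' by rewrite /R' trmxCV hR.
have R'R : R' *m R = 1%:M by exact: mulVmx.
have RR' : R *m R' = 1%:M by exact: mulmxV.
have R'R' : R' *m R' = invmx T.
  rewrite -[LHS](mulmxK (posdef_unit pT)) (_ : R' *m R' *m T = 1%:M) ?mul1mx //.
  by rewrite -[X in _ *m X]RR -mulmxA [R' *m (R *m R)]mulmxA R'R mul1mx.
(* The square of the entry is at most [c], and [c <= (c + 1)^2] spares a square root. Real [s >= 1]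
   are enough to compare degrees. *)
have entry_bound s k : 1 <= s -> `|(R *m mx_eval F s - R') k j| <= c + 1.
  move=> s1; have s0 : 0 < s by rewrite (lt_le_trans ltr01).
  have Re_s : 0 < 'Re s by rewrite (Creal_ReP _ _) // gtr0_real.
  have [_ /(@psd_diag _ _ j)] := hpF s Re_s; rewrite /HP_defect /=.
  set Fs := mx_eval F s; move=> defect_ge0; set E := R *m Fs - R'.
  have EE : E^t* *m E = invmx T - T - (Fs + Fs^t* - (T + Fs^t* *m T *m Fs)).
    rewrite trmxCB trmxCM hR HR' mulmxBl !mulmxBr R'R' !mulmxA R'R mul1mx.
    rewrite -[_ *m R *m R']mulmxA RR' mulmx1.
    rewrite -[_ *m R *m R]mulmxA RR.
    by apply/matrixP => a b; rewrite !mxE; ring.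
  have le_c : `|E k j| ^+ 2 <= c.
    have : (E^t* *m E) j j <= c by rewrite EE [leLHS]mxE gerDl mxE oppr_le0.
    clearbody E; apply: le_trans; rewrite mxE (bigD1 k) //= !mxE normCKC lerDl.
    rewrite sumr_ge0 // => l _.
    by rewrite !mxE mulrC mul_conjC_ge0.
  have c0 : 0 <= c by rewrite (le_trans _ le_c) // exprn_ge0.
  rewrite -(@ler_pXn2r _ 2) ?nnegrE ?addr_ge0 // (le_trans le_c) //.
  rewrite sqrrD mulr1 expr1n (le_trans (_ : _ <= c *+ 2)) ?mulr2n ?lerDl //.
  by rewrite -addrA addrCA lerDl addr_ge0 ?exprn_ge0.
have M0 : 0 <= M.
  rewrite sumr_ge0 // => k _; rewrite mulr_ge0 // addr_ge0 //.
  by rewrite (le_trans _ (entry_bound 1 k _)).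
apply: (size_le_of_bounded M0) => s s1.
have s0 : 0 < s by rewrite (lt_le_trans ltr01).
have Re_s : 0 < 'Re s by rewrite (Creal_ReP _ _) // gtr0_real.
have [/(_ i j) dens _] := hpF s Re_s.
rewrite -ler_pdivrMr ?normr_gt0 // -normf_div.
have -> : (rat_num (F i j)).[s] / (rat_den (F i j)).[s] =
    (R' *m ((R *m mx_eval F s - R') + R')) i j.
  by rewrite subrK mulmxA R'R mul1mx mxE.
rewrite mxE (le_trans (ler_norm_sum _ _ _)) // ler_sum // => k _.
rewrite normrM ler_wpM2l // mxE (le_trans (ler_normD _ _)) // lerD2r.
exact: entry_bound.
Qed.

End Canonical.

(** * Normalization of the state and of the feedthrough *)

Section NormalForms.
Variable C : numClosedFieldType.

Lemma trmxC_congr m n (T : 'M[C]_m) (K : 'M[C]_(m, n)) :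
  T^t* = T -> (K^t* *m T *m K)^t* = K^t* *m T *m K.
Proof. by move=> hT; rewrite !trmxCM trmxCK hT mulmxA. Qed.

(** On a vector whose whole orbit is killed by [K], the term [N K] never acts, so both matrices have
    the same orbit. *)
Lemma observable_output_injection m n (A : 'M[C]_n) (K : 'M[C]_(m, n)) (N : 'M[C]_(n, m)) :
  observable A K -> observable (A + N *m K) K.
Proof.
move=> obs; apply: inj_observable => x Kx; apply: (observable_inj obs) => k.
have Ak l : A ^+ l *m x = (A + N *m K) ^+ l *m x.
  elim: l => [|l IHl]; first by rewrite !expr0.
  rewrite !exprS -!mulmxA IHl mulmxDl -!mulmxA [K *m (_ *m x)]mulmxA Kx.
  by rewrite mulmx0 addr0.
by rewrite -mulmxA Ak mulmxA Kx.
Qed.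

(** Completion of the square in [D], with weight the inverse of [T]. *)
Lemma lossless_feedthroughP m (D T : 'M[C]_m) : T^t* = T -> T \in unitmx ->
  D + D^t* = T + D^t* *m T *m D <->
  (1%:M - T *m D)^t* *m invmx T *m (1%:M - T *m D) = invmx T - T.
Proof.
move=> hT uT.
have -> : (1%:M - T *m D)^t* *m invmx T *m (1%:M - T *m D) =
    invmx T - (D + D^t*) + D^t* *m T *m D.
  rewrite trmxCB trmxC1 trmxCM hT mulmxBl mul1mx mulmxK // mulmxBl !mulmxBr !mulmx1 mulKmx //.
  by rewrite mulmxA; apply/matrixP => i j; rewrite !mxE; ring.
split=> [->|E]; first by apply/matrixP => i j; rewrite !mxE; ring.
have -> : D + D^t* = invmx T + D^t* *m T *m D - (invmx T - (D + D^t*) + D^t* *m T *m D).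
  by apply/matrixP => i j; rewrite !mxE; ring.
by rewrite E; apply/matrixP => i j; rewrite !mxE; ring.
Qed.

(** In the coordinates given by [S], the square root of [P], the Lyapunov solution becomes the
    identity. The equation then fixes the Hermitian part of [A'] in terms of [K'], and [Y] is its
    skew-Hermitian part. *)
Lemma canonical_normalized m n (A : 'M[C]_n) (B : 'M[C]_(n, m)) (K : 'M[C]_(m, n))
    (D T : 'M[C]_m) F :
  posdef T -> canonical_HP T F -> minimal_realization A B K D F ->
  exists (L Y : 'M[C]_n), let K' := K *m L in
  [/\ L \in unitmx, Y + Y^t* = 0, observable Y K',
      minimal_realization (- (2^-1 *: (K'^t* *m T *m K')) + Y)
        (K'^t* *m (1%:M - T *m D)) K' D F &
      D + D^t* = T + D^t* *m T *m D].
Proof.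
move=> pT canF minF; have [hT _] := pT.
have [P pP [EP EB ED]] := canonical_lyapunov pT canF minF.
have [_ SS hS uS] := mxsqrt_posdef pP; move: (mxsqrt P) SS hS uS => S SS hS uS.
set K' := K *m invmx S; pose A' := S *m A *m invmx S.
have hK' : K'^t* = invmx S *m K^t* by rewrite trmxCM trmxCV hS.
have EA' : A' + A'^t* = - (K'^t* *m T *m K').
  have -> : K'^t* *m T *m K' = invmx S *m (K^t* *m T *m K) *m invmx S.
    by rewrite hK' /K' !mulmxA.
  rewrite -[K^t* *m T *m K]opprK -EP mulmxN mulNmx opprK mulmxDr mulmxDl -SS.
  rewrite !mulmxA mulVmx // mul1mx -[invmx S *m A^t* *m S *m S *m invmx S]mulmxA mulmxV //.
  by rewrite mulmx1 addrC /A' !trmxCM trmxCV hS !mulmxA.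
have EB' : S *m B = K'^t* *m (1%:M - T *m D).
  by rewrite hK' -mulmxA -EB -SS !mulmxA mulVmx // mul1mx.
have minF' := realization_similar uS minF.
pose Y := A' + 2^-1 *: (K'^t* *m T *m K').
have EY : - (2^-1 *: (K'^t* *m T *m K')) + Y = A' by rewrite addrC addrK.
exists (invmx S), Y; rewrite /= -/K' EY -EB' unitmx_inv; split=> //.
  rewrite trmxCD trmxCZ trmxC_congr // addrACA EA' fmorphV rmorph_nat -scalerDl.
  by rewrite -[2^-1]mul1r -splitr scale1r addNr.
rewrite /Y scalemxAl; apply: observable_output_injection.
exact: minimal_observable minF'.
Qed.

Lemma canonical_of_normalized m n (Y : 'M[C]_n) (K : 'M[C]_(m, n)) (D T : 'M[C]_m) F :
  posdef T -> Y + Y^t* = 0 -> observable Y K ->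
  realization (- (2^-1 *: (K^t* *m T *m K)) + Y) (K^t* *m (1%:M - T *m D)) K D F ->
  D + D^t* = T + D^t* *m T *m D -> canonical_HP T F.
Proof.
move=> pT EY obs rF ED; have [hT _] := pT.
apply: (canonical_of_lyapunov (posdef1 C n) pT rF) => //; last by rewrite mul1mx.
  rewrite addrC scalemxAl -scaleN1r scalemxAl; exact: observable_output_injection.
rewrite mulmx1 mul1mx trmxCD trmxCN trmxCZ trmxC_congr // fmorphV rmorph_nat.
rewrite addrACA [Y^t* + Y]addrC EY addr0 -opprD -scalerDl.
by rewrite -[2^-1]mul1r -splitr scale1r.
Qed.

Section AllPass.
Variables (m : nat) (T : 'M[C]_m).
Hypotheses (pT : posdef T) (pT1 : posdef (1%:M - T)).
Let R := mxsqrt T.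
Let Q := mxsqrt (invmx T - T).

(** [T^-1 - T] splits as [R^-1 (1 - T) R^-1 + (1 - T)], where [R] is the square root of [T]. *)
Lemma posdef_invB : posdef (invmx T - T).
Proof.
have [_ RR hR uR] := mxsqrt_posdef pT.
have RT : invmx R *m T = R by rewrite -RR mulKmx.
have -> : invmx T - T = (invmx R)^t* *m (1%:M - T) *m invmx R + (1%:M - T).
  rewrite trmxCV hR mulmxBr mulmxBl mulmx1 RT mulmxV // addrA subrK.
  congr (_ - _); rewrite -[RHS](mulmxK (posdef_unit pT)).
  by rewrite -[X in X *m _]mulmxA RT mulVmx // mul1mx.
apply: posdefD; last exact: posdef_psd.
by apply: posdef_congr; rewrite ?unitmx_inv.
Qed.

(** By the completed square [R^-1 (1 - T D)] and [Q] have the same Gram matrix; as [Q] is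
    invertible, the former is [U Q] with [U] unitary, which is solved for [D]. *)
Lemma lossless_feedthrough_unitaryP (D : 'M[C]_m) :
  D + D^t* = T + D^t* *m T *m D <->
  exists2 U : 'M[C]_m, U^t* *m U = 1%:M & D = invmx T - invmx R *m U *m Q.
Proof.
have [_ RR hR uR] := mxsqrt_posdef pT; have uT := posdef_unit pT; have [hT _] := pT.
have [_ QQ hQ uQ] := mxsqrt_posdef posdef_invB.
rewrite -/R -/Q in RR hR uR QQ hQ uQ.
have TR : T *m invmx R = R by rewrite -RR mulmxK.
have TV : invmx R *m invmx R = invmx T.
  by rewrite -[LHS](mulKmx uT) [T *m _]mulmxA TR mulmxV // mulmx1.
move: R Q RR hR uR QQ hQ uQ TR TV => R' Q' RR hR uR QQ hQ uQ TR TV.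
rewrite lossless_feedthroughP //; split=> [E|[U UU ->]].
  exists (invmx R' *m (1%:M - T *m D) *m invmx Q').
    rewrite !trmxCM !trmxCV hR hQ.
    have -> : invmx Q' *m ((1%:M - T *m D)^t* *m invmx R') *m
        (invmx R' *m (1%:M - T *m D) *m invmx Q') = invmx Q' *m
        ((1%:M - T *m D)^t* *m (invmx R' *m invmx R') *m (1%:M - T *m D)) *m invmx Q'.
      by rewrite !mulmxA.
    by rewrite TV E -QQ mulKmx // mulmxV.
  rewrite -[_ *m _ *m Q']mulmxA mulmxKV // mulmxA TV mulmxBr mulmx1 mulKmx //.
  by rewrite opprB addrC subrK.
have -> : 1%:M - T *m (invmx T - invmx R' *m U *m Q') = R' *m U *m Q'.
  by rewrite mulmxBr mulmxV // !mulmxA TR opprB addrC subrK.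
rewrite !trmxCM hR hQ -QQ -TV -!mulmxA; congr (_ *m _).
by rewrite mulKVmx // mulKmx // mulmxA UU mul1mx.
Qed.
End AllPass.
End NormalForms.

(** * Normal forms, Gramians and completion *)

Section Corollary.
Variable C : numClosedFieldType.

Section General.
Variables (m : nat) (T : 'M[C]_m).
Hypotheses (pT : posdef T) (pT1 : posdef (1%:M - T)).
Let T12 := mxsqrt T.
Let Q := mxsqrt (invmx T - T).

(** The rank condition on [K] is stated apart: changes of state coordinates preserve it, so it
    passes between [F] and its normal form. *)
Definition HP_form n (U : 'M[C]_m) (Y : 'M[C]_n) (K : 'M[C]_(m, n)) F : Prop :=
  [/\ U^t* *m U = 1%:M, Y + Y^t* = 0, observable Y K &
      minimal_realization
        (- (2^-1 *: (K^t* *m T *m K)) + Y) (K^t* *m T12 *m U *m Q)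
        K (invmx T - invmx T12 *m U *m Q) F].

Lemma HP_form_feedthrough (U : 'M[C]_m) :
  1%:M - T *m (invmx T - invmx T12 *m U *m Q) = T12 *m U *m Q.
Proof.
have [_ RR _ uR] := mxsqrt_posdef pT.
rewrite mulmxBr mulmxV ?posdef_unit // opprB addrC subrK !mulmxA.
by rewrite -{1}RR mulmxK.
Qed.

Lemma HP_form_of_minimal n (A : 'M[C]_n) B K D F :
  canonical_HP T F -> minimal_realization A B K D F ->
  exists (L : 'M[C]_n) U Y, L \in unitmx /\ HP_form U Y (K *m L) F.
Proof.
move=> canF minF.
have [L [Y /= [uL EY obs minF' ED]]] := canonical_normalized pT canF minF.
have [U UU ED'] := (lossless_feedthrough_unitaryP pT pT1 D).1 ED.
exists L, U, Y; split=> //; split=> //.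
have EB : (K *m L)^t* *m (1%:M - T *m D) = (K *m L)^t* *m T12 *m U *m Q.
  by rewrite ED' HP_form_feedthrough; move: T12 Q => R' Q'; rewrite !mulmxA.
by rewrite -EB -ED'.
Qed.

Lemma canonical_of_HP_form n U (Y : 'M[C]_n) K F : HP_form U Y K F -> canonical_HP T F.
Proof.
move=> [UU EY obs [rF _]].
apply: (canonical_of_normalized (D := invmx T - invmx T12 *m U *m Q) pT EY obs).
  by rewrite HP_form_feedthrough; move: T12 Q rF => R' Q'; rewrite !mulmxA.
by apply/(lossless_feedthrough_unitaryP pT pT1); exists U.
Qed.

End General.

Lemma canonical_minimal m (T : 'M[C]_m) F : posdef T -> canonical_HP T F ->
  exists n (A : 'M[C]_n) (B : 'M[C]_(n, m)) (K : 'M[C]_(m, n)) (D : 'M[C]_m),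
    minimal_realization A B K D F.
Proof. by move=> pT [hpF _]; exact/proper_minimal_realization/(canonical_proper pT). Qed.

Lemma full_rank_unit m n (K : 'M[C]_(m, n)) L :
  L \in unitmx -> full_rank K -> full_rank (K *m L).
Proof. by move=> uL; rewrite /full_rank mxrankMfree // row_free_unit. Qed.

(** * The scalar case [T = b I], with [r = sqrt (1 - b^2)] and [q = sqrt r] *)

Section Scalar.
Variables (m : nat) (b r q : C).
Hypotheses (b_gt0 : 0 < b) (r_gt0 : 0 < r) (q_gt0 : 0 < q).
Hypotheses (qq : q * q = r) (rr : r * r = 1 - b * b).

Let b0 : b != 0. Proof. by rewrite gt_eqF. Qed.
Let r0 : r != 0. Proof. by rewrite gt_eqF. Qed.
Let q0 : q != 0. Proof. by rewrite gt_eqF. Qed.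
Let bC : b^* = b. Proof. by apply/CrealP; rewrite gtr0_real. Qed.
Let rC : r^* = r. Proof. by apply/CrealP; rewrite gtr0_real. Qed.
Let qC : q^* = q. Proof. by apply/CrealP; rewrite gtr0_real. Qed.
Let pb : posdef (b%:M : 'M[C]_m).
Proof. exact: posdef_scalar. Qed.

Lemma scalar_feedthroughP (D : 'M[C]_m) :
  D + D^t* = b%:M + D^t* *m b%:M *m D <->
  (1%:M - b *: D)^t* *m (1%:M - b *: D) = (r * r)%:M.
Proof.
have -> : (1%:M - b *: D)^t* *m (1%:M - b *: D) =
    1%:M - b *: (D + D^t* - D^t* *m b%:M *m D).
  rewrite trmxCB trmxC1 trmxCZ bC mulmxBl mul1mx mulmxBr mulmx1.
  rewrite -!scalemxAl -!scalemxAr mul_mx_scalar -scalemxAl.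
  by apply/matrixP => i j; rewrite !mxE; ring.
rewrite rr; split=> [->|E].
  by rewrite addrK scale_scalar_mx raddfB.
apply/eqP; rewrite -subr_eq; apply/eqP/(scalerI b0).
rewrite -[LHS](subKr 1%:M) E scale_scalar_mx raddfB /=.
by rewrite opprB addrC subrK.
Qed.

(** The normal form for [T = b I] has input matrix [r K^* U] and output matrix [K]. Multiplying the
    state by [q^-1] shares the factor [r] equally between the two, which balances the
    realization. *)
Definition scalar_HP_form n (U : 'M[C]_m) (Y : 'M[C]_n) (K : 'M[C]_(m, n)) F : Prop :=
  let A := - ((b / 2) *: (K^t* *m K)) + Y in
  let B := q *: (K^t* *m U) in
  let K' := q *: K in
  let D := b^-1 *: (1%:M - r *: U) in
  [/\ U^t* *m U = 1%:M, Y + Y^t* = 0, observable Y K,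
      minimal_realization A B K' D F & balanced A B K'].

Lemma scalar_HP_form_lyapunov n (Y : 'M[C]_n) (K : 'M[C]_(m, n)) : Y + Y^t* = 0 ->
  let A := - ((b / 2) *: (K^t* *m K)) + Y in A + A^t* = - (b *: (K^t* *m K)).
Proof.
move=> EY /=; rewrite trmxCD trmxCN trmxCZ trmxCM trmxCK addrACA EY addr0.
rewrite rmorphM /= fmorphV rmorph_nat bC -opprD -scalerDl.
by rewrite -splitr.
Qed.

(** The common Gramian is the scalar [r / b]: [A + A^*] is [- b K^* K], while [B B^*] and the Gram
    matrix of the output are both [r K^* K]. *)
Lemma scalar_HP_form_balanced n (U : 'M[C]_m) (Y : 'M[C]_n) K :
  U^t* *m U = 1%:M -> Y + Y^t* = 0 ->
  balanced (- ((b / 2) *: (K^t* *m K)) + Y) (q *: (K^t* *m U)) (q *: K).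
Proof.
move=> UU EY; set A := _ + _; have EA := scalar_HP_form_lyapunov K EY.
exists (r / b)%:M; have pH : posdef ((r / b)%:M : 'M[C]_n).
  by apply: posdef_scalar; rewrite divr_gt0.
have EH : - ((r / b) *: (A + A^t*)) = r *: (K^t* *m K).
  by rewrite EA scalerN opprK scalerA divfK.
split; split=> //; rewrite mul_mx_scalar mul_scalar_mx -scalerDr 1?[A^t* + _]addrC EH.
  rewrite trmxCZ qC -scalemxAl -scalemxAr scalerA qq trmxCM trmxCK mulmxA.
  by rewrite -[K^t* *m U *m _]mulmxA (mulmx1C UU) mulmx1.
by rewrite trmxCZ qC -scalemxAl -scalemxAr scalerA qq.
Qed.

Lemma scalar_HP_form_of_minimal n (A : 'M[C]_n) B K D F :
  canonical_HP b%:M F -> minimal_realization A B K D F ->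
  exists (L : 'M[C]_n) U Y, L \in unitmx /\ scalar_HP_form U Y (K *m L) F.
Proof.
move=> canF minF.
have [L [Y /= [uL EY obs minF' ED]]] := canonical_normalized pb canF minF.
pose U := r^-1 *: (1%:M - b *: D).
have UU : U^t* *m U = 1%:M.
  rewrite trmxCZ fmorphV /= rC -scalemxAl -scalemxAr (scalar_feedthroughP D).1 //.
  by rewrite scalerA scale_scalar_mx -invfM mulVf // mulf_neq0.
have rU : r *: U = 1%:M - b *: D by rewrite scalerA divff // scale1r.
exists L, U, Y; split=> //; split=> //; last exact: scalar_HP_form_balanced.
have uq : (q^-1)%:M \in @unitmx C n.
  by rewrite unitmxE det_scalar unitfE expf_neq0 ?invr_eq0.
have := realization_similar uq minF'; rewrite invmx_scalar invrK.
rewrite !mul_scalar_mx !mul_mx_scalar scalerA divff // scale1r -rU.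
rewrite -[(b *: _) *m _]scalemxAl scalerA [2^-1 * _]mulrC.
have -> : q^-1 *: ((K *m L)^t* *m (r *: U)) = q *: ((K *m L)^t* *m U).
  by rewrite -scalemxAr scalerA -qq mulKf.
have -> : D = b^-1 *: (1%:M - r *: U).
  by rewrite rU opprB addrC subrK scalerA mulVf // scale1r.
exact.
Qed.

Lemma canonical_of_scalar_HP_form n U (Y : 'M[C]_n) K F :
  scalar_HP_form U Y K F -> canonical_HP b%:M F.
Proof.
move=> [UU EY obs [rF _] _].
have bD : 1%:M - b *: (b^-1 *: (1%:M - r *: U)) = r *: U.
  by rewrite scalerA divff // scale1r opprB addrC subrK.
(* The output matrix is [q K], so the right-hand side of the Lyapunov equation gains the factor
   [q^2 = r], and the solution is [r] instead of the identity. *)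
have pP : posdef (r%:M : 'M[C]_n) by exact: posdef_scalar.
apply: (canonical_of_lyapunov pP pb rF).
- apply: inj_observable => x Kx; apply: (observable_inj (K := K)
    (observable_output_injection (- (b / 2) *: K^t*) obs)) => k.
  apply: (scalerI q0); rewrite scaler0 -(Kx k) -!scalemxAl scaleNr.
  by rewrite [Y + _]addrC.
- rewrite mul_mx_scalar mul_scalar_mx -scalerDr [_^t* + _]addrC scalar_HP_form_lyapunov //.
  rewrite mul_mx_scalar trmxCZ qC -!scalemxAl -!scalemxAr !scalerA -qq scalerN scalerA.
  by congr (- (_ *: _)); ring.
- rewrite !mul_scalar_mx bD trmxCZ qC -scalemxAl -scalemxAr !scalerA.
  by rewrite mulrC.
apply/scalar_feedthroughP; rewrite bD trmxCZ rC -scalemxAl -scalemxAr UU scalerA.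
by rewrite scale_scalar_mx mulr1.
Qed.

(** [P / b] solves the observability equation at once. For the other, [1 - b D] is [r] times a
    unitary matrix, so [B B^* = r^2 P^-1 K^* K P^-1], and the Lyapunov equation for [P] multiplied
    by [P^-1] on both sides gives the Gramian [(r^2 / b) P^-1]. *)
Lemma canonical_gramians n (A : 'M[C]_n) (B : 'M[C]_(n, m)) K D F :
  canonical_HP b%:M F -> minimal_realization A B K D F ->
  exists Wc Wo : 'M[C]_n, [/\ ctrl_gramian A B Wc, obs_gramian A K Wo &
    Wc *m Wo = ((r / b) ^+ 2)%:M].
Proof.
move=> canF minF; have [P pP [EP EB ED]] := canonical_lyapunov pb canF minF.
have uP := posdef_unit pP.
rewrite mul_mx_scalar -scalemxAl in EP; rewrite mul_scalar_mx in EB.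
exists ((r * r / b) *: invmx P), (b^-1 *: P); split.
- split; first by apply: posdefZ (posdefV pP); rewrite divr_gt0 ?mulr_gt0.
  have VV : (1%:M - b *: D) *m (1%:M - b *: D)^t* = (r * r)%:M.
    have E := (scalar_feedthroughP D).1 ED.
    have rr0 : r * r != 0 by rewrite mulf_neq0.
    apply: (scalerI (a := (r * r)^-1)); first by rewrite invr_eq0.
    rewrite scalemxAl scale_scalar_mx mulVf //; apply: mulmx1C.
    by rewrite -scalemxAr E scale_scalar_mx mulVf.
  have -> : B = invmx P *m (K^t* *m (1%:M - b *: D)) by rewrite -EB mulKmx.
  have [hP _] := posdefV pP.
  rewrite !trmxCM hP trmxCK -!mulmxA [_ *m (_ *m (K *m _))]mulmxA VV mul_scalar_mx.
  have -> : K^t* *m ((r * r) *: (K *m invmx P)) =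
      ((r * r) / b) *: (b *: (K^t* *m K)) *m invmx P.
    by rewrite scalerA divfK // -scalemxAl -scalemxAr mulmxA.
  rewrite -[b *: _]opprK -EP -scalemxAl -scalemxAr -scalemxAl -scalerDr -scalerN.
  rewrite -[in RHS]scalemxAr; congr (_ *: _); rewrite mulNmx mulmxN mulmxDl mulmxDr.
  by rewrite !mulmxA mulVmx // mul1mx mulmxK.
- split; first by apply: posdefZ pP; rewrite invr_gt0.
  rewrite -scalemxAl -scalemxAr -scalerDr addrC EP scalerN opprK scalerA mulVf //.
  by rewrite scale1r.
rewrite -scalemxAl -scalemxAr mulVmx // scalerA scalemx1; congr _%:M.
by rewrite expr2; ring.
Qed.

Lemma char_poly_scalar n (a : C) : char_poly (a%:M : 'M_n) = \prod_(i < n) ('X - a%:P).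
Proof.
rewrite char_poly_trig ?scalar_mx_is_trig //; apply: eq_bigr => i _.
by rewrite mxE eqxx.
Qed.

(** With [S] the square root of [Wc], the product is similar to the Hermitian matrix [S Wo S], which
    is diagonalizable; its only eigenvalue being [a], it is scalar. *)
Lemma gramian_product_scalar n (Wc Wo : 'M[C]_n) (a : C) :
  posdef Wc -> Wo^t* = Wo -> char_poly (Wc *m Wo) = \prod_(i < n) ('X - a%:P) ->
  Wc *m Wo = a%:M.
Proof.
move=> pWc hWo chi; have [_ SS hS uS] := mxsqrt_posdef pWc.
move: (mxsqrt Wc) SS hS uS => S SS hS uS.
set H := S *m Wo *m S.
have hH : H^t* = H by rewrite !trmxCM hS hWo mulmxA.
have WcWo : Wc *m Wo = S *m H *m invmx S by rewrite /H -SS !mulmxA mulmxK.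
suff H_a : H = a%:M by rewrite WcWo H_a scalar_mxC -mulmxA mulmxV // mulmx1.
have nH : H \is normalmx by apply/normalmxP; rewrite hH.
have EH := orthomx_spectralP nH.
set U := spectralmx H in EH; set d := spectral_diag H in EH.
have uU : U \in unitmx by exact: spectral_unit.
suff d_a i : d 0 i = a.
  rewrite EH (_ : diag_mx d = a%:M) ?scalar_mxC -?mulmxA ?mulVmx ?mulmx1 //.
  by apply/matrixP => i j; rewrite !mxE d_a.
have : root (char_poly (Wc *m Wo)) (d 0 i).
  rewrite root_char_poly; apply/negP.
  have -> : (d 0 i)%:M - Wc *m Wo =
      (S *m invmx U) *m ((d 0 i)%:M - diag_mx d) *m (U *m invmx S).
    rewrite WcWo EH mulmxBr mulmxBl scalar_mxC !mulmxA; congr (_ - _).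
    by rewrite -[_ *m invmx U *m U]mulmxA mulVmx // mulmx1 -mulmxA mulmxV // mulmx1.
  rewrite !unitmx_mul => /andP[/andP[_ +] _].
  rewrite unitmxE det_trig ?unitfE; last first.
    by apply/is_trig_mxP => j k jk; rewrite !mxE -val_eqE ltn_eqF //= subr0.
  by move/prodf_neq0/(_ i isT); rewrite !mxE eqxx subrr eqxx.
rewrite chi /root horner_prod => /prodf_eq0[j _].
by rewrite hornerXsubC subr_eq0 => /eqP.
Qed.

End Scalar.

(* The feedthrough is read off [P B = K^* (1 - b D)] for [P = b Wo]. *)
Lemma canonical_completion m n (b s : C) (A : 'M[C]_n) (B : 'M[C]_(n, m)) K D0 Phi Wc Wo :
  0 < b -> 0 < s -> b * b * (1 + s * s) = 1 ->
  minimal_realization A B K D0 Phi -> ctrl_gramian A B Wc -> obs_gramian A K Wo ->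
  Wc *m Wo = (s * s)%:M ->
  exists D : 'M[C]_m, canonical_HP b%:M (mx_const D + Phi).
Proof.
move=> b0 s0 bs minPhi [pWc EWc] [pWo EWo] WcWo.
have bN0 : b != 0 by rewrite gt_eqF.
have sC : s^* = s by apply/CrealP; rewrite gtr0_real.
have [hWo _] := pWo.
have WoWc : Wo *m Wc = (s * s)%:M.
  have ss0 : s * s != 0 by rewrite mulf_neq0 ?gt_eqF.
  apply: (scalerI (a := (s * s)^-1)); first by rewrite invr_eq0.
  rewrite scalemxAl scale_scalar_mx mulVf //; apply: mulmx1C.
  by rewrite -scalemxAr WcWo scale_scalar_mx mulVf.
(* The controllability equation multiplied by [Wo] on both sides becomes [s^2] times the
   observability equation, since [Wo Wc = s^2]. Thus [Wo B] and [s K^*] have the same Gram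
   matrix. *)
have [V uV EV] : exists2 V, V \is unitarymx & Wo *m B = (s *: K^t*) *m V.
  apply: gram_unitary; rewrite trmxCM trmxCZ sC trmxCK hWo -scalemxAl -scalemxAr scalerA.
  rewrite mulmxA -[_ *m B *m B^t*]mulmxA -EWc -EWo mulmxN mulNmx scalerN; congr (- _).
  rewrite mulmxDr mulmxDl mulmxA WoWc mul_scalar_mx -[Wo *m (A *m Wc) *m Wo]mulmxA.
  by rewrite -[A *m Wc *m Wo]mulmxA WcWo mul_mx_scalar -scalemxAr -scalemxAl scalerDr addrC.
pose D := b^-1 *: (1%:M - (b * s) *: V).
have bD : 1%:M - b *: D = (b * s) *: V.
  by rewrite scalerA divff // scale1r opprB addrC subrK.
have VV : V^t* *m V = 1%:M by apply/mulmx1C/unitarymxP.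
(* [D] is the feedthrough of the sum, and [D0] is already part of [Phi]. *)
exists (D - D0).
have pb : posdef (b%:M : 'M[C]_m) by exact: posdef_scalar.
have pP : posdef (b *: Wo) by exact: posdefZ.
apply: (canonical_of_lyapunov (A := A) (B := B) (K := K) (D := D) pP pb).
- have [-> _] := minPhi; rewrite /realization mx_constB.
  by rewrite addrCA subrK.
- exact: minimal_observable minPhi.
- rewrite -scalemxAr -scalemxAl -scalerDr addrC mul_mx_scalar -scalemxAl.
  by rewrite -scalerN -EWo opprK.
- by rewrite mul_scalar_mx bD -scalemxAl EV -scalemxAl -scalemxAr scalerA.
(* The relation between [b] and [s] says that [b * s] is the square root of [1 - b^2]. *)
apply/(scalar_feedthroughP (r := b * s)); rewrite ?mulr_gt0 //.
  by rewrite -[1 in RHS]bs; ring.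
rewrite bD trmxCZ rmorphM /= sC (CrealP _) ?gtr0_real // -scalemxAl -scalemxAr VV.
by rewrite scalerA scalemx1.
Qed.

End Corollary.

(** * The four statements over the complex numbers *)

Unset Implicit Arguments.
Local Open Scope complex_scope.

Theorem corollary1p12 (R : realType) (m : nat) :
  (* (i) *)
  (forall T : 'M[R[i]]_m, posdef T -> posdef (1%:M - T) ->
    let T12 := mxsqrt T in
    let Q := mxsqrt (invmx T - T) in
    let form n (U : 'M_m) (Y : 'M_n) (K : 'M_(m, n)) (F : rat_mx R[i] m) :=
      [/\ U^t* *m U = 1%:M, Y + Y^t* = 0, observable Y K &
          minimal_realization
            (- (2^-1 *: (K^t* *m T *m K)) + Y) (K^t* *m T12 *m U *m Q)
            K (invmx T - invmx T12 *m U *m Q) F] in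
    forall F : rat_mx R[i] m,
      (canonical_HP T F <-> exists n U Y K, @form n U Y K F) /\
      (canonical_HP T F /\ full_rank_output F <->
       exists n U Y K, full_rank K /\ @form n U Y K F)) /\
  (* (ii) *)
  (forall beta : R, 0 < beta < 1 ->
    let r := Num.sqrt (1 - beta ^+ 2) in
    let form n (U : 'M_m) (Y : 'M_n) (K : 'M_(m, n)) (F : rat_mx R[i] m) :=
      let A := - ((beta / 2)%:C *: (K^t* *m K)) + Y in
      let B := (Num.sqrt r)%:C *: (K^t* *m U) in
      let K' := (Num.sqrt r)%:C *: K in
      let D := (beta^-1)%:C *: (1%:M - r%:C *: U) in
      [/\ U^t* *m U = 1%:M, Y + Y^t* = 0, observable Y K,
          minimal_realization A B K' D F & balanced A B K'] in
    forall F : rat_mx R[i] m,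
      (canonical_HP (beta%:C)%:M F <-> exists n U Y K, @form n U Y K F) /\
      (canonical_HP (beta%:C)%:M F /\ full_rank_output F <->
       exists n U Y K, full_rank K /\ @form n U Y K F)) /\
  (* (iii) *)
  (forall (beta : R) (F : rat_mx R[i] m) (n : nat), 0 < beta < 1 ->
    canonical_HP (beta%:C)%:M F -> mcmillan_degree F n ->
    hankel_singular_values F
      (fun _ : 'I_n => (Num.sqrt (1 - beta ^+ 2) / beta)%:C)) /\
  (* (iv) *)
  (forall (Phi : rat_mx R[i] m) (n : nat) (sigma : 'I_n -> R[i]),
    vanishes_at_infinity Phi -> hankel_singular_values Phi sigma ->
    (forall i j, sigma i = sigma j) ->
    exists (D : 'M[R[i]]_m) (beta : R),
      0 < beta < 1 /\ canonical_HP (beta%:C)%:M (mx_const D + Phi)).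
Proof.
pose cst (x : R) : R[i] := x%:C.
have cst_gt0 x : 0 < x -> 0 < cst x by rewrite ltcR.
split; [|split; [|split]].
- move=> T pT pT1 T12 Q form F; split; split.
  + move=> canF; have [n [A [B [K [D minF]]]]] := canonical_minimal pT canF.
    have [L [U [Y [_ formF]]]] := HP_form_of_minimal pT pT1 canF minF.
    by exists n, U, Y, (K *m L).
  + by move=> [n [U [Y [K formF]]]]; exact: (canonical_of_HP_form pT pT1 formF).
  + move=> [canF [n [A [B [K [D [minF rkK]]]]]]].
    have [L [U [Y [uL formF]]]] := HP_form_of_minimal pT pT1 canF minF.
    by exists n, U, Y, (K *m L); split=> //; exact: full_rank_unit.
  + move=> [n [U [Y [K [rkK formF]]]]].
    split; first exact: (canonical_of_HP_form pT pT1 formF).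
    by case: formF => _ _ _ minF; do 5 eexists; split; [exact: minF|].
- move=> beta /andP[b0 b1] r form F.
  have r0 : 0 < r by rewrite sqrtr_gt0 subr_gt0 expr_lt1 // ltW.
  have q0 : 0 < Num.sqrt r by rewrite sqrtr_gt0.
  have qq : cst (Num.sqrt r) * cst (Num.sqrt r) = cst r.
    by rewrite -rmorphM -expr2 sqr_sqrtr // ltW.
  have rr : cst r * cst r = 1 - cst beta * cst beta.
    rewrite -!rmorphM -(rmorph1 (real_complex R)) -rmorphB /= -!expr2 sqr_sqrtr //.
    by rewrite subr_ge0 expr_le1 // ltW.
  have formE n (U : 'M_m) (Y : 'M_n) (K : 'M_(m, n)) G :
      form n U Y K G <-> scalar_HP_form (cst beta) (cst r) (cst (Num.sqrt r)) U Y K G.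
    by rewrite /form /scalar_HP_form /cst !rmorphM !fmorphV rmorph_nat.
  have cb0 := cst_gt0 _ b0; have cr0 := cst_gt0 _ r0; have cq0 := cst_gt0 _ q0.
  have pb := posdef_scalar m cb0.
  have of_form n (U : 'M_m) (Y : 'M_n) (K : 'M_(m, n)) G :
      form n U Y K G -> canonical_HP (cst beta)%:M G.
    by move=> /formE; exact: canonical_of_scalar_HP_form.
  split; split.
  + move=> canF; have [n [A [B [K [D minF]]]]] := canonical_minimal pb canF.
    have [L [U [Y [_ formF]]]] := scalar_HP_form_of_minimal cb0 cr0 cq0 qq rr canF minF.
    by exists n, U, Y, (K *m L); apply/formE.
  + by move=> [n [U [Y [K /of_form]]]].
  + move=> [canF [n [A [B [K [D [minF rkK]]]]]]].
    have [L [U [Y [uL formF]]]] := scalar_HP_form_of_minimal cb0 cr0 cq0 qq rr canF minF.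
    by exists n, U, Y, (K *m L); split; [exact: full_rank_unit | apply/formE].
  + move=> [n [U [Y [K [rkK formF]]]]]; split; first exact: of_form formF.
    case: formF => _ _ _ minF _; do 5 eexists; split; first exact: minF.
    by rewrite /full_rank mxrank_scale_nz // gt_eqF.
- move=> beta F n /andP[b0 b1] canF degF; set r := Num.sqrt (1 - beta ^+ 2).
  have r0 : 0 < r by rewrite sqrtr_gt0 subr_gt0 expr_lt1 // ltW.
  have rr : cst r * cst r = 1 - cst beta * cst beta.
    rewrite -!rmorphM -(rmorph1 (real_complex R)) -rmorphB /= -!expr2 sqr_sqrtr //.
    by rewrite subr_ge0 expr_le1 // ltW.
  have rb : (r / beta)%:C = cst r / cst beta by rewrite rmorphM fmorphV.
  split=> // [i|A B K D minF]; first by rewrite lecR divr_ge0 // ltW.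
  have [Wc [Wo [cWc oWo WcWo]]] :=
    canonical_gramians (cst_gt0 _ b0) (cst_gt0 _ r0) rr canF minF.
  exists Wc, Wo; split=> //; rewrite WcWo char_poly_scalar; apply: eq_bigr => i _.
  by rewrite rb.
- move=> Phi n sigma _ [sig0 [A [B [K [D0 minPhi]]]] hsv] sigE.
  have [Wc [Wo [[pWc EWc] [pWo EWo] chi]]] := hsv _ _ _ _ minPhi.
  have [s s0 sigs] : exists2 s : R, 0 < s & forall i, sigma i = cst s.
    case: n => [|n] in sigma sig0 A B K minPhi hsv sigE Wc Wo pWc EWc pWo EWo chi *.
      (* Without any singular value every positive [s] serves. *)
      by exists 1 => // -[].
    have /complex_realP[s Es] : sigma 0 \is Num.real by rewrite ger0_real.
    exists s => [|i]; last by rewrite (sigE i 0) Es.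
    rewrite -ltcR -Es lt_def sig0 andbT; apply/eqP => sig00.
    (* A zero singular value would make the product of the Gramians zero, although both are
       invertible. *)
    have WcWo : Wc *m Wo = 0%:M.
      apply: gramian_product_scalar => //; first by case: pWo.
      by rewrite chi; apply: eq_bigr => i _; rewrite (sigE i 0) sig00 expr0n.
    have : Wc *m Wo \in unitmx by rewrite unitmx_mul !posdef_unit.
    by rewrite WcWo unitmxE det_scalar expr0n unitr0.
  have WcWo : Wc *m Wo = (cst s * cst s)%:M.
    apply: gramian_product_scalar => //; first by case: pWo.
    by rewrite chi; apply: eq_bigr => i _; rewrite sigs expr2.
  pose t := 1 + s * s.
  have t1 : 1 < t by rewrite ltrDl mulr_gt0.
  have t0 : 0 < t by rewrite (lt_trans ltr01).
  (* The solution of [s = sqrt (1 - beta^2) / beta]; it is below 1 because [s] is positive. *)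
  pose beta := (Num.sqrt t)^-1.
  have b0 : 0 < beta by rewrite invr_gt0 sqrtr_gt0.
  have bs : cst beta * cst beta * (1 + cst s * cst s) = 1.
    rewrite -!rmorphM -(rmorph1 (real_complex R)) -rmorphD -rmorphM /= -/t.
    by rewrite -invfM -expr2 sqr_sqrtr ?mulVf // ?gt_eqF // ltW.
  have [D canF] := canonical_completion (cst_gt0 _ b0) (cst_gt0 _ s0) bs minPhi
    (conj pWc EWc) (conj pWo EWo) WcWo.
  exists D, beta; split=> //; rewrite b0 invf_lt1 ?sqrtr_gt0 //.
  by rewrite -sqrtr1 ltr_sqrt.
Qed.
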